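(* Suppose $k\in\mathbb{N}$ ($k\ge1$), $\theta_1,\ldots,\theta_k\in[0,2\pi)$, and $T\in\mathcal{M}_N(\mathbb{R})$ is a direct sum $$T=R_{\theta_1}\oplus\cdots\oplus R_{\theta_k}\oplus B\oplus C$$ where $B$ is a real square matrix with $B^2=I$ and $C$ is a real square matrix with $r(C)<1$ (the summands $B$ and $C$ might not be present). The following are equivalent: (1) $T$ is orbit reflexive; (2) $T$ is $\mathbb{R}$-orbit reflexive; (3) there are nonzero integers $s_1,\ldots,s_k$ and an integer $t$ such that $\sum_{j=1}^k s_j\theta_j=2\pi t$; (4) for every $j\in\{1,\ldots,k\}$, $\theta_j/2\pi\in \mathrm{sp}_{\mathbb{Q}}\left(\{1\}\cup\{\theta_i/2\pi: 1\le i\le k,\ i\ne j\}\right)$.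
   Context: For $T\in\mathcal{M}_N(\mathbb{R})$, acting on $\mathbb{R}^N$, let $\mathrm{Orb}(T)=\{T^n:n\ge0\}$ and $\mathbb{R}\text{-}\mathrm{Orb}(T)=\{\lambda T^n:\lambda\in\mathbb{R},\ n\ge 0\}$; for a vector $x$ write $\mathrm{Orb}(T)x=\{T^nx:n\ge0\}$ and $\mathbb{R}\text{-}\mathrm{Orb}(T)x=\{\lambda T^nx:\lambda\in\mathbb{R},\ n\ge0\}$. Let $\mathrm{OrbRef}(T)$ (resp. $\mathbb{R}\text{-}\mathrm{OrbRef}(T)$) be the set of all $S\in\mathcal{M}_N(\mathbb{R})$ such that $Sx$ lies in the closure of $\mathrm{Orb}(T)x$ (resp. of $\mathbb{R}\text{-}\mathrm{Orb}(T)x$) for every $x\in\mathbb{R}^N$. $T$ is orbit reflexive if $\mathrm{OrbRef}(T)$ equals the closure of $\mathrm{Orb}(T)$ in $\mathcal{M}_N(\mathbb{R})$, and $\mathbb{R}$-orbit reflexive if $\mathbb{R}\text{-}\mathrm{OrbRef}(T)$ equals the closure of $\mathbb{R}\text{-}\mathrm{Orb}(T)$ in $\mathcal{M}_N(\mathbb{R})$. $R_\theta=\begin{pmatrix}\cos\theta&-\sin\theta\\ \sin\theta&\cos\theta\end{pmatrix}$; $r(C)=\lim_{n\to\infty}\|C^n\|^{1/n}$ is the spectral radius of $C$ viewed as a complex matrix; $\mathrm{sp}_{\mathbb{Q}}$ denotes linear span over $\mathbb{Q}$ in $\mathbb{R}$. *)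

(* Defs.v *)
From mathcomp Require Import all_boot all_order all_algebra complex.
From mathcomp Require Import all_classical all_reals all_analysis.

Set Implicit Arguments.
Unset Strict Implicit.
Unset Printing Implicit Defensive.

Import Order.TTheory GRing.Theory Num.Theory.
Import numFieldNormedType.Exports.

Local Open Scope classical_set_scope.
Local Open Scope ring_scope.

Definition Orb (R : realType) (N : nat) (T : 'M[R]_N) : set 'M[R]_N :=
  [set T ^+ n | n in [set: nat]].

Definition ROrb (R : realType) (N : nat) (T : 'M[R]_N) : set 'M[R]_N :=
  [set c *: T ^+ n | c in [set: R] & n in [set: nat]].

Definition OrbRef (R : realType) (N : nat) (T : 'M[R]_N) : set 'M[R]_N :=
  [set S | forall x : 'cV[R]_N, closure [set A *m x | A in Orb T] (S *m x)].

Definition ROrbRef (R : realType) (N : nat) (T : 'M[R]_N) : set 'M[R]_N :=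
  [set S | forall x : 'cV[R]_N, closure [set A *m x | A in ROrb T] (S *m x)].

Definition orbit_reflexive (R : realType) (N : nat) (T : 'M[R]_N) : Prop :=
  OrbRef T = closure (Orb T).

Definition R_orbit_reflexive (R : realType) (N : nat) (T : 'M[R]_N) : Prop :=
  ROrbRef T = closure (ROrb T).

Definition rotation (R : realType) (theta : R) : 'M[R]_2 :=
  \matrix_(i < 2, j < 2)
    if i == j then cos theta else if i == 0 then - sin theta else sin theta.

(* The norm on 'M[R[i]]_q is the library's (maximum modulus of the entries,
   with values in R[i], whence Re); the limit is the same for every norm.
   When q = 0 the norm is 0, and so is the limit. *)
Definition spectral_radius (R : realType) (q : nat) (A : 'M[R[i]]_q) : R :=
  limn (fun n : nat => (complex.Re `|A ^+ n|) `^ n%:R^-1).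

Definition spanQ (R : realType) (A : set R) : set R :=
  [set x | exists (n : nat) (a : 'I_n -> R) (c : 'I_n -> rat),
     (forall i, A (a i)) /\ x = \sum_(i < n) ratr (c i) * a i].

(* Main.v *)
(** A relation with nonzero coefficients on the angles gives, for every limit [A] of scalar
    multiples of powers of [T], a polynomial relation between the complex entries [z_i] of its
    rotation blocks. If [S] is in the reflexive hull, each [S x] is some [A x] (compactness), and
    the relation, tested while one coordinate of [x] varies, rules out reflections: every block
    of [S] is complex linear. Then only countably many [A] can agree with [S] on generic vectors,
    and since the moment curve meets proper subspaces in finite sets, [S] is one of them.
    Conversely, if some angle is rationally independent of the others and of [pi], Kronecker's
    theorem shows that [T^n] can approximate any rotation in that plane, the identity in the
    other planes and on [B], and [0] on [C]; hence a reflection in that plane lies in the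
    reflexive hull, but not in the closure of the orbit. The hypothesis on the spectral radius
    is converted to [C^n -> 0] by Fekete's lemma, which also shows that the limit exists. *)
Require Import Defs.
From mathcomp Require Import all_boot all_order all_algebra complex.
From mathcomp Require Import all_classical all_reals all_analysis.
From mathcomp Require Import ring lra zify.

Set Implicit Arguments.
Unset Strict Implicit.
Unset Printing Implicit Defensive.

Import Order.TTheory GRing.Theory Num.Theory.
Import numFieldNormedType.Exports.

Local Open Scope classical_set_scope.
Local Open Scope ring_scope.
Local Open Scope complex_scope.

(** * The complex exponential of a real angle *)

Definition expi (R : realType) (x : R) : R[i] := cos x +i* sin x.

Lemma expi0 (R : realType) : expi (0 : R) = 1.
Proof. by rewrite /expi cos0 sin0. Qed.

Lemma expiD (R : realType) (x y : R) : expi (x + y) = expi x * expi y.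
Proof.
by rewrite /expi cosD sinD; apply/eqP; rewrite eq_complex /= eqxx/= addrC.
Qed.

Lemma expiN (R : realType) (x : R) : expi (- x) = conjc (expi x).
Proof. by rewrite /expi cosN sinN. Qed.

Lemma expi_mulJ (R : realType) (x : R) : expi x * conjc (expi x) = 1.
Proof. by rewrite -expiN -expiD subrr expi0. Qed.

Lemma expi_neq0 (R : realType) (x : R) : expi x != 0.
Proof. by apply/eqP => x0; have := expi_mulJ x; rewrite x0 mul0r => /eqP;
  rewrite eq_sym oner_eq0. Qed.

Lemma expiM_nat (R : realType) n (x : R) : expi (n%:R * x) = expi x ^+ n.
Proof.
elim: n => [|n IH]; first by rewrite mul0r expi0.
by rewrite -addn1 natrD mulrDl mul1r expiD IH addn1 exprSr.
Qed.

Lemma expiV (R : realType) (x : R) : expi (- x) = (expi x)^-1.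
Proof.
by apply: (mulIf (expi_neq0 x)); rewrite -expiD addNr expi0 mulVf ?expi_neq0.
Qed.

Lemma expiM_int (R : realType) (n : int) (x : R) : expi (n%:~R * x) = expi x ^ n.
Proof.
case: n => n; first by rewrite -exprnP -expiM_nat.
by rewrite NegzE mulrNz mulNr expiV -pmulrn expiM_nat exprnN.
Qed.

Lemma expi_sum (R : realType) (I : finType) (F : I -> R) :
  expi (\sum_i F i) = \prod_i expi (F i).
Proof.
apply: (big_ind2 (fun x y => expi x = y)) => //; first exact: expi0.
by move=> x1 x2 y1 y2 <- <-; rewrite expiD.
Qed.

Lemma expi_pi (R : realType) : expi (pi : R) = -1.
Proof. by rewrite /expi cospi sinpi; apply/eqP; rewrite eq_complex /= oppr0 !eqxx. Qed.

Lemma expi_2pi_int (R : realType) (t : int) : expi (2 * pi * t%:~R : R) = 1.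
Proof.
rewrite [X in expi X](_ : _ = t%:~R * (2%:R * pi)); last by rewrite mulrC.
by rewrite expiM_int expiM_nat expi_pi sqrrN !expr1n exp1rz.
Qed.

(** Subtracting the right multiple of [pi] moves [x] into [[0, pi)], where the sine vanishes only at
    0. *)
Lemma sin_eq0_int (R : realType) (x : R) : sin x = 0 -> exists t : int, x = pi * t%:~R.
Proof.
move=> sx; have p0 := pi_gt0 R.
set t := Num.floor (x / pi); exists t.
have /andP[l u] := floor_itv (x / pi).
rewrite ler_pdivlMr// in l; rewrite ltr_pdivrMr// intrD mulrDl mul1r in u.
set y := x - t%:~R * pi.
have y0 : 0 <= y by rewrite subr_ge0.
have y1 : y < pi by rewrite ltrBlDl.
suff : y = 0 by move/eqP; rewrite subr_eq0 => /eqP ->; rewrite mulrC.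
(* A shift by a multiple of [pi] multiplies [expi] by 1 or -1, so it preserves the zeros of the
   sine. *)
have sy : sin y = 0.
  have : expi y = expi x * (-1) ^ (- t).
    by rewrite /y expiD -mulNr -mulrNz expiM_int expi_pi.
  have [->|->] : (-1) ^ (- t) = 1 :> R[i] \/ (-1) ^ (- t) = -1 :> R[i].
    case: (- t) => n; rewrite ?NegzE -?exprnN -?exprnP -signr_odd; case: odd;
      rewrite ?expr1 ?expr0 ?invr1 ?invrN1; tauto.
  - by rewrite mulr1 /expi => -[_ ->].
  - by rewrite mulrN1 /expi => -[_ ->]; rewrite sx oppr0.
apply/eqP; rewrite eq_le y0 andbT leNgt; apply/negP => yp.
by have := @sin_gt0_pi _ y; rewrite yp y1 sy ltxx => /(_ isT).
Qed.

Lemma expi_onto (R : realType) (c s : R) :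
  c ^+ 2 + s ^+ 2 = 1 -> exists x : R, expi x = c +i* s.
Proof.
move=> cs; have c1 : -1 <= c <= 1.
  have := sqr_ge0 s; rewrite !expr2 in cs * => ?; apply/andP; split; nra.
have [s0|s0] := leP 0 s.
  exists (acos c); rewrite /expi acosK ?in_itv//= sin_acos//.
  by rewrite -cs addrC addKr sqrtr_sqr ger0_norm.
exists (- acos c); rewrite /expi cosN sinN acosK ?in_itv//= sin_acos//.
by rewrite -cs addrC addKr sqrtr_sqr ltr0_norm ?opprK.
Qed.

Lemma cos_sum_bound (R : realType) (w b : R) : sin (w / 2) != 0 ->
  exists D, forall n, `|\sum_(0 <= m < n) cos (m%:R * w - b)| <= D.
Proof.
move=> s0; exists `|sin (w / 2)|^-1 => n.
have sp : 0 < `|sin (w / 2)| by rewrite normr_gt0.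
rewrite -(ler_pM2l sp) divff ?gt_eqF// -normrM mulr_sumr.
(* Telescoping: [sin (w / 2) * cos (m w - b)] is half the difference of the sines of
   [m w - b + w / 2] and [m w - b - w / 2]. *)
pose F (m : nat) : R := sin (m%:R * w - b - w / 2) / 2.
rewrite (telescope_sumr_eq F)//.
  rewrite /F -mulrBl normrM (ger0_norm (_ : 0 <= 2^-1 :> R))// ler_pdivrMr// mul1r.
  apply: le_trans (ler_normB _ _) _.
  by rewrite [leRHS](_ : 2 = 1 + 1)// lerD ?sin_max.
move=> m _; rewrite /F.
rewrite [X in sin X / 2 - _](_ : _ = (m%:R * w - b) + w / 2); last first.
  by rewrite -natr1; field.
by rewrite sinB sinD; field.
Qed.

(** * A quantitative form of Kronecker's theorem *)

(** Since [(1 + cos y) / 2 = (1 + expi y) ^+ 2 * expi (- y) / 4], this is the binomial formula. The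
    index [a] carries the frequency [a - L], so [a = L] is the constant term. *)
Lemma fejer_expand (R : realType) (L : nat) (y : R) :
  (((1 + cos y) / 2) ^+ L)%:C =
  \sum_(a < (2 * L).+1) ('C(2 * L, a)%:R / 4 ^+ L)%:C * expi ((a%:R - L%:R) * y).
Proof.
have e4 : (((1 + cos y) / 2)%:C : R[i]) = (1 + expi y) ^+ 2 * expi (- y) * (4^-1)%:C.
  have := cos2Dsin2 y; rewrite /expi cosN sinN !expr2 => cs.
  have cs1 := congr1 (fun z => z * (2 + cos y)) cs.
  have cs2 := congr1 (fun z => z * sin y) cs.
  apply/eqP; rewrite eq_complex /=; apply/andP; split; apply/eqP; rewrite /= in cs1 cs2;
    first nra; lra.
transitivity ((((1 + cos y) / 2)%:C) ^+ L); first exact: (rmorphXn (real_complex R)).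
rewrite e4 exprMn exprMn -exprM exprDn.
rewrite mulr_suml mulr_suml; apply: eq_bigr => a _.
rewrite expr1n mul1r mulrBl -mulrN expiD !expiM_nat -[(4^-1)%:C ^+ L](rmorphXn (real_complex R)).
have -> : ('C(2 * L, a)%:R / 4 ^+ L)%:C = 'C(2 * L, a)%:R * ((4^-1) ^+ L)%:C :> R[i].
  by rewrite exprVn (rmorphM (real_complex R)) /= (rmorph_nat (real_complex R)).
by rewrite -mulr_natl; ring.
Qed.

(** The central coefficient is the largest of [2 L + 1] numbers with sum [4 ^ L]. The induction uses
    the ratio of consecutive central coefficients. *)
Lemma central_bin_ge (L : nat) : (4 ^ L <= (2 * L).+1 * 'C(2 * L, L))%N.
Proof.
elim: L => // L IH.
have h : (L.+1 * 'C(2 * L.+1, L.+1) = 2 * (2 * L).+1 * 'C(2 * L, L))%N.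
  have h1 := mul_bin_diag (2 * L).+2 L.
  have h2 : ('C((2 * L).+1, L) = 'C((2 * L).+1, L.+1))%N.
    by rewrite -bin_sub; last lia; congr ('C(_, _)); lia.
  have h3 := mul_bin_diag (2 * L).+1 L.
  rewrite (_ : 2 * L.+1 = (2 * L).+2)%N; last lia.
  by rewrite -h1 /= h2 -mulnA h3 mulnA; congr (_ * _)%N; lia.
rewrite -(leq_pmul2l (ltn0Sn L)).
rewrite (_ : L.+1 * ((2 * L.+1).+1 * 'C(2 * L.+1, L.+1)) = (2 * L).+3 * (L.+1 * 'C(2 * L.+1,
  L.+1)))%N; last lia.
rewrite h expnS; nia.
Qed.

Lemma poly_lt_geometric (R : realType) (k : nat) (e : R) : 0 < e ->
  exists L : nat, (0 < L)%N /\ (2 * L).+1%:R ^+ k < expR (L%:R * e).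
Proof.
move=> e0.
(* The term of degree [k + 1] of the exponential series at [L e] is [c L ^ (k + 1)]; it exceeds
   [(3 L) ^ k] once [L > 3 ^ k / c]. *)
pose c := e ^+ k.+1 / k.+1`!%:R.
have c0 : 0 < c by rewrite divr_gt0 ?exprn_gt0 ?ltr0n ?fact_gt0.
have [L hL] : exists L : nat, 3 ^+ k / c < L%:R.
  by exists (Num.Def.archi_bound (3 ^+ k / c)); apply: archi_boundP;
    rewrite divr_ge0 ?exprn_ge0// ltW.
have L0 : (0 < L)%N.
  by rewrite -(ltr0n R); apply: le_lt_trans hL; rewrite divr_ge0 ?exprn_ge0// ltW.
exists L; split => //.
have Le0 : 0 <= L%:R * e by rewrite mulr_ge0 ?ler0n// ltW.
apply: lt_le_trans (expR_ge1Dxn k Le0).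
apply: le_lt_trans (_ : (3 * L%:R) ^+ k < _).
  by rewrite lerXn2r ?nnegrE// -natrM ler_nat; lia.
rewrite ltr_wpDl//.
rewrite !exprMn exprS -!mulrA [X in _ * (_ * X)](_ : _ = c)//.
rewrite mulrCA mulrC ltr_pM2l ?exprn_gt0 ?ltr0n//.
by rewrite ltr_pdivrMr in hL.
Qed.

Lemma cos_2pi_int (R : realType) (t : int) : cos (2 * pi * t%:~R : R) = 1.
Proof. by have [] := expi_2pi_int R t. Qed.

(* A resonant frequency carries no phase, hence contributes nonnegatively; the other
   frequencies have bounded sums. *)
Lemma cos_sum_ge (R : realType) (w b : R) (M : nat) :
  (forall t : int, w = 2 * pi * t%:~R -> b = 0) ->
  exists D, forall n, - D <= \sum_(0 <= m < n) cos ((m + M)%:R * w - b).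
Proof.
move=> hb; have [/sin_eq0_int[t wt]|s0] := eqVneq (sin (w / 2)) 0.
  have {}wt : w = 2 * pi * t%:~R by rewrite -mulrA -wt; field.
  exists 0 => n; rewrite oppr0 sumr_ge0// => m _.
  rewrite (hb t wt) subr0 wt (_ : _ * _ = 2 * pi * ((m + M)%:Z * t)%:~R) ?cos_2pi_int//.
  by rewrite intrM; ring.
have [D hD] := cos_sum_bound (b - M%:R * w) s0; exists D => n.
have := hD n; rewrite ler_norml => /andP[+ _]; congr (_ <= _).
by apply: eq_bigr => m _; rewrite natrD; congr (cos _); ring.
Qed.

Lemma ReD (R : realType) (x y : R[i]) : complex.Re (x + y) = complex.Re x + complex.Re y.
Proof. by case: x => ? ?; case: y. Qed.

Lemma fejer_prod_expand (R : realType) (k L : nat) (y : 'I_k -> R) :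
  \prod_(i < k) ((1 + cos (y i)) / 2) ^+ L =
  \sum_(f : {ffun 'I_k -> 'I_(2 * L).+1})
     (\prod_i ('C(2 * L, f i)%:R / 4 ^+ L)) * cos (\sum_i ((f i)%:R - L%:R) * y i).
Proof.
have H : (\prod_(i < k) ((1 + cos (y i)) / 2) ^+ L)%:C = \sum_(f : {ffun 'I_k -> 'I_(2 * L).+1})
   (\prod_i ('C(2 * L, f i)%:R / 4 ^+ L))%:C * expi (\sum_i ((f i)%:R - L%:R) * y i).
  rewrite [LHS](rmorph_prod (real_complex R)).
  under eq_bigr do rewrite /= fejer_expand.
  rewrite bigA_distr_bigA /=; apply: eq_bigr => f _.
  by rewrite big_split /= expi_sum; congr (_ * _); rewrite [RHS](rmorph_prod (real_complex R)).
have := congr1 (@complex.Re R) H; rewrite /= => ->.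
rewrite (big_morph _ (@ReD R) (erefl _)); apply: eq_bigr => f _.
by rewrite /= mul0r subr0.
Qed.

(* If no [m] worked, the product of the kernels [((1 + cos y_i) / 2) ^+ L] would be at most
   [(1 - e / 2) ^+ L] along the tail, while its mean is at least its constant coefficient,
   which decays only polynomially in [L]. *)
Lemma kronecker (R : realType) (k : nat) (phi alpha : 'I_k -> R) (j : 'I_k) :
  (forall i, i != j -> alpha i = 0) ->
  (forall (s : 'I_k -> int) (t : int),
     \sum_i (s i)%:~R * phi i = 2 * pi * t%:~R -> s j = 0) ->
  forall (e : R) (M : nat), 0 < e ->
  exists m : nat, (M <= m)%N /\ forall i, 1 - e < cos (m%:R * phi i - alpha i).
Proof.
move=> halpha hindep e M e0; apply: contrapT => H.
have {}H m : (M <= m)%N -> exists i, cos (m%:R * phi i - alpha i) <= 1 - e.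
  move=> Mm; apply: contrapT => H1; apply: H; exists m; split=> // i.
  by rewrite ltNge; apply/negP => H2; apply: H1; exists i.
(* A factor [(1 + cos y) / 2] with [cos y <= 1 - e] is at most [rho]. *)
pose rho := 1 - e / 2.
have rho0 : 0 <= rho.
  have [i hi] := H M (leqnn M); have := cos_geN1 (M%:R * phi i - alpha i).
  by rewrite /rho; lra.
have [L [L0 hL]] := poly_lt_geometric k (divr_gt0 e0 (ltr0n R 2)).
pose c (a : nat) : R := 'C(2 * L, a)%:R / 4 ^+ L.
have c_ge0 a : 0 <= c a by rewrite divr_ge0// exprn_ge0.
have cL : (2 * L).+1%:R^-1 <= c L.
  rewrite ler_pdivlMr ?exprn_gt0// ler_pdivrMl ?ltr0n//.
  by rewrite -natrX -natrM ler_nat central_bin_ge.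
(* [rho ^+ L] is at most [exp (- L e / 2)], which by the choice of [L] is below [(2 L + 1) ^ - k],
   hence below [c L ^+ k]. *)
have rhoL : rho ^+ L < c L ^+ k.
  apply: (@lt_le_trans _ _ ((2 * L).+1%:R^-1 ^+ k)); last first.
    by rewrite lerXn2r// nnegrE ?invr_ge0.
  apply: (@le_lt_trans _ _ (expR (L%:R * (e / 2)))^-1).
    rewrite -expRN -mulrN expRM_natl lerXn2r ?nnegrE ?expR_ge0//.
    exact: expR_ge1Dx.
  by rewrite exprVn ltf_pV2 ?posrE ?exprn_gt0 ?expR_gt0.
pose g (m : nat) := \prod_(i < k) ((1 + cos (m%:R * phi i - alpha i)) / 2) ^+ L.
have g_le m : (M <= m)%N -> g m <= rho ^+ L.
  move=> /H[i hi]; rewrite /g (bigD1 i)//=.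
  have hge0 (x : R) : 0 <= (1 + cos x) / 2 by have := cos_geN1 x; lra.
  rewrite -[leRHS]mulr1; apply: ler_pM.
  - exact: exprn_ge0.
  - by apply: prodr_ge0 => i' _; exact: exprn_ge0.
  - by rewrite lerXn2r ?nnegrE// /rho; lra.
  - apply: prodr_ile1 => i' _; rewrite exprn_ge0//= exprn_ile1//.
    by have := cos_le1 (m%:R * phi i' - alpha i'); lra.
pose J := {ffun 'I_k -> 'I_(2 * L).+1}.
pose C (f : J) := \prod_i c (f i).
have C_ge0 f : 0 <= C f by apply: prodr_ge0 => i _.
pose w (f : J) := \sum_i ((f i)%:R - L%:R) * phi i.
pose b (f : J) := \sum_i ((f i)%:R - L%:R) * alpha i.
have gE m : g m = \sum_(f : J) C f * cos (m%:R * w f - b f).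
  rewrite /g fejer_prod_expand; apply: eq_bigr => f _; congr (_ * cos _).
  by rewrite /w /b mulr_sumr -sumrB; apply: eq_bigr => i _; ring.
(* At a resonant frequency the hypothesis on [j] forces [f j = L]; as [alpha] vanishes off [j], the
   phase [b f] is then 0. *)
have hD f : exists D, forall n, - D <= \sum_(0 <= m < n) cos ((m + M)%:R * w f - b f).
  apply: cos_sum_ge => t wt.
  have fj : ((f j)%:Z - L%:Z)%R = 0 :> int.
    apply: (hindep (fun i => (f i)%:Z - L%:Z) t); rewrite -wt; apply: eq_bigr => i _.
    by rewrite intrB.
  rewrite /b big1// => i _; have [->|ij] := eqVneq i j; last by rewrite halpha ?mulr0.
  have -> : (f j)%:R - L%:R = ((f j)%:Z - L%:Z)%:~R :> R by rewrite intrB.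
  by rewrite fj mul0r.
have [D {}hD] := choice hD.
(* The constant choice [L] has zero frequency and zero phase, so its term contributes exactly
   [n * c L ^+ k] to the sum over [n] instants. *)
pose f0 : J := [ffun=> inord L].
have f0E i : f0 i = L :> nat by rewrite ffunE inordK//; lia.
have Cf0 : C f0 = c L ^+ k.
  by rewrite /C (eq_bigr (fun=> c L)) ?prodr_const ?card_ord// => i _; rewrite f0E.
pose K := \sum_(f | f != f0) C f * D f.
have key n : n%:R * (c L ^+ k - rho ^+ L) <= K.
  have h1 : \sum_(0 <= m < n) g (m + M)%N <= n%:R * rho ^+ L.
    rewrite mulr_natl -[n in _ *+ n]subn0 -sumr_const_nat.
    by apply: ler_sum => m _; apply: g_le; rewrite leq_addl.
  have h2 : \sum_(0 <= m < n) g (m + M)%N =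
     \sum_(f : J) C f * \sum_(0 <= m < n) cos ((m + M)%:R * w f - b f).
    under eq_bigr do rewrite gE.
    by rewrite exchange_big; apply: eq_bigr => f _; rewrite mulr_sumr.
  have h3 : \sum_(0 <= m < n) cos ((m + M)%:R * w f0 - b f0) = n%:R.
    rewrite (eq_bigr (fun=> 1)) ?sumr_const_nat ?subn0// => m _.
    have -> : w f0 = 0 by rewrite /w big1// => i _; rewrite f0E subrr mul0r.
    have -> : b f0 = 0 by rewrite /b big1// => i _; rewrite f0E subrr mul0r.
    by rewrite mulr0 subr0 cos0.
  move: h1; rewrite h2 (bigD1 f0)//= h3 Cf0.
  have : - K <= \sum_(f | f != f0) C f * \sum_(0 <= m < n) cos ((m + M)%:R * w f - b f).
    rewrite -sumrN; apply: ler_sum => f _; rewrite -mulrN; exact: ler_wpM2l.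
  by move: (\sum_(f | _) _) => S; rewrite mulrBr [c L ^+ k * _]mulrC; lra.
have d0 : 0 < c L ^+ k - rho ^+ L by rewrite subr_gt0.
have K0 : 0 <= K by have := key 0; rewrite mul0r.
have := archi_boundP (divr_ge0 K0 (ltW d0)).
by rewrite ltr_pdivrMr// ltNge key.
Qed.

(** * Rational dependence of the angles *)

(** The relation is solved for [theta j]. The slot [j] of the family, free because [theta j] is
    excluded, holds the generator 1. *)
Lemma rel_spanQ (R : realType) (k : nat) (theta : 'I_k -> R) (j : 'I_k)
    (s : 'I_k -> int) (t : int) :
  \sum_i (s i)%:~R * theta i = 2 * pi * t%:~R -> s j != 0 ->
  spanQ ([set 1] `|` [set theta i / (2 * pi) | i in [set i | i != j]])
        (theta j / (2 * pi)).
Proof.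
have : 2 * pi != 0 :> R by rewrite mulf_neq0 ?gt_eqF ?pi_gt0.
move: (2 * pi) => P p0 st sj.
exists k, (fun i => if i == j then 1 else theta i / P),
  (fun i => if i == j then t%:~R / (s j)%:~R else - (s i)%:~R / (s j)%:~R).
split=> [i|]; first by case: eqVneq => ij; [left | right; exists i].
have sj0 : (s j)%:~R != 0 :> R by rewrite intr_eq0.
rewrite (bigD1 j)//= eqxx mulr1.
rewrite (eq_bigr (fun i => - ((s i)%:~R * theta i) / ((s j)%:~R * P))); last first.
  move=> i /negbTE ->; rewrite fmorph_div rmorphN /= !ratr_int; field.
  by rewrite sj0 p0.
rewrite -mulr_suml sumrN fmorph_div /= !ratr_int.
move: st; rewrite (bigD1 j)//=; set S := \sum_(i | _) _ => st.
have -> : S = P * t%:~R - (s j)%:~R * theta j by rewrite -st addrAC subrr add0r.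
by field; rewrite sj0 p0.
Qed.

Lemma spanQ_rel (R : realType) (k : nat) (theta : 'I_k -> R) (j : 'I_k) :
  spanQ ([set 1] `|` [set theta i / (2 * pi) | i in [set i | i != j]])
        (theta j / (2 * pi)) ->
  exists (s : 'I_k -> int) (t : int),
    s j != 0 /\ \sum_i (s i)%:~R * theta i = 2 * pi * t%:~R.
Proof.
have : 2 * pi != 0 :> R by rewrite mulf_neq0 ?gt_eqF ?pi_gt0.
move: (2 * pi) => P p0.
(* [G x] clears denominators: a nonzero integer multiple of [P x] is an integral combination of [P]
   and of the angles other than [theta j]. It is stable under sums and rational multiples. *)
pose G (x : R) := exists (d : int) (s : 'I_k -> int) (t : int),
  [/\ d != 0, s j = 0 & d%:~R * (P * x) = \sum_i (s i)%:~R * theta i + P * t%:~R].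
have GD x y : G x -> G y -> G (x + y).
  move=> [d [s [t [d0 sj e]]]] [d' [s' [t' [d'0 s'j e']]]].
  exists (d * d'), (fun i => d' * s i + d * s' i), (d' * t + d * t'); split.
  - by rewrite mulf_neq0.
  - by rewrite sj s'j !mulr0.
  have -> : (d * d')%:~R * (P * (x + y)) = d'%:~R * (d%:~R * (P * x)) + d%:~R * (d'%:~R * (P *
    y)).
    by rewrite intrM; ring.
  rewrite e e'.
  rewrite [in RHS](eq_bigr (fun i =>
    d'%:~R * ((s i)%:~R * theta i) + d%:~R * ((s' i)%:~R * theta i))); last first.
    by move=> i _ /=; rewrite intrD !intrM mulrDl -!mulrA.
  by rewrite big_split /= -!mulr_sumr intrD !intrM; ring.
have GZ (q : rat) x : G x -> G (ratr q * x).
  move=> [d [s [t [d0 sj e]]]].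
  exists (denq q * d), (fun i => numq q * s i), (numq q * t); split.
  - by rewrite mulf_neq0 ?denq_neq0.
  - by rewrite sj mulr0.
  rewrite [in RHS](eq_bigr (fun i => (numq q)%:~R * ((s i)%:~R * theta i))); last by move=> i _;
    rewrite intrM mulrA.
  rewrite -mulr_sumr /ratr !intrM.
  have dq : (denq q)%:~R != 0 :> R by rewrite intr_eq0 denq_neq0.
  transitivity ((numq q)%:~R * (d%:~R * (P * x))); first by field.
  by rewrite e; ring.
have G0 : G 0.
  exists 1, (fun=> 0), 0; split=> //; rewrite !mulr0 addr0 big1// => i _.
  by rewrite mul0r.
have G1 : G 1.
  exists 1, (fun=> 0), 1; split=> //; rewrite big1 ?add0r ?mul1r ?mulr1//.
  by move=> i _; rewrite mul0r.
have Gt i : i != j -> G (theta i / P).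
  move=> ij; exists 1, (fun i' => (i' == i)%:Z), 0; split=> //.
    by rewrite eq_sym (negbTE ij).
  rewrite (bigD1 i)//= eqxx big1 ?mulr0 ?addr0.
    by change (1%:~R * (P * (theta i / P)) = 1%:~R * theta i); congr (_ * _); rewrite mulrC divfK.
  by move=> i' /negbTE ->; rewrite mul0r.
move=> [n [a [c [ha e]]]].
have : G (theta j / P).
  rewrite e; apply: (big_ind G) => // m _; apply: GZ.
  by have [->|[i ij <-]] := ha m; [exact: G1 | exact: Gt].
move=> [d [s [t [d0 sj]]]]; rewrite [P * _]mulrC divfK// => {}e.
exists (fun i => if i == j then d else - s i), t; rewrite eqxx; split=> //.
rewrite (bigD1 j)//= eqxx e (bigD1 j)//= sj mul0r add0r.
rewrite [X in _ + X](eq_bigr (fun i => - ((s i)%:~R * theta i))).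
  by rewrite sumrN addrAC subrr add0r.
by move=> i /negbTE ->; rewrite intrN mulNr.
Qed.

(** Coordinates are made nonzero one at a time. Given a relation [s] good up to [m] and one [v] good
    at [m], the relation [c s + v] is good up to [m + 1] when [c] exceeds every [|v i|]: no
    cancellation is possible where [s i] is nonzero. *)
Lemma rel_all_neq0 (R : realType) (k : nat) (theta : 'I_k -> R) :
  (forall j, exists (s : 'I_k -> int) (t : int),
    s j != 0 /\ \sum_i (s i)%:~R * theta i = 2 * pi * t%:~R) ->
  exists (s : 'I_k -> int) (t : int),
    (forall j, s j != 0) /\ \sum_i (s i)%:~R * theta i = 2 * pi * t%:~R.
Proof.
move=> H.
suff Hm m : (m <= k)%N -> exists (s : 'I_k -> int) (t : int),
    (forall j : 'I_k, (j < m)%N -> s j != 0) /\ \sum_i (s i)%:~R * theta i = 2 * pi * t%:~R.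
  have [s [t [hs st]]] := Hm k (leqnn k).
  by exists s, t; split=> // j; apply: hs.
elim: m => [_|m IH mk].
  by exists (fun=> 0), 0; split=> //; rewrite big1 ?mulr0// => i _; rewrite mul0r.
have [s [t [hs st]]] := IH (ltnW mk).
have [v [u [hv vu]]] := H (Ordinal mk).
have [c vc] : exists c : int, forall j, `|v j| < c.
  exists (1 + \sum_i `|v i|) => j.
  by rewrite (bigD1 j)//= addrCA -{1}[`|v j|]addr0 ltrD2l ltr_wpDr// sumr_ge0.
exists (fun i => c * s i + v i), (c * t + u); split; last first.
  rewrite (eq_bigr (fun i => c%:~R * ((s i)%:~R * theta i) + (v i)%:~R * theta i)); last first.
    by move=> i _ /=; rewrite intrD [(c * s i)%:~R]intrM mulrDl -mulrA.
  by rewrite big_split -mulr_sumr /= st vu intrD [(c * t)%:~R]intrM; ring.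
move=> j jm.
have [sj|sj] := eqVneq (s j) 0.
  rewrite sj mulr0 add0r.
  move: jm; rewrite ltnS leq_eqVlt => /orP[/eqP jm|/hs]; last by rewrite sj eqxx.
  by rewrite (_ : j = Ordinal mk)//; apply: val_inj.
apply/eqP => /eqP; rewrite addr_eq0 => /eqP e.
have : c <= `|v j|.
  rewrite -normrN -e normrM ger0_norm; last by apply: le_trans (ltW (vc j)).
  by rewrite ler_peMr//; [apply: le_trans (ltW (vc j)) | lia].
by rewrite leNgt vc.
Qed.

(** * The spectral radius and powers of matrices *)

Lemma cvg_root (R : realType) (c : R) : 0 < c -> (fun n : nat => c `^ n%:R^-1) @ \oo --> (1 : R).
Proof.
move=> c0.
rewrite (_ : (fun n : nat => _) = (fun n : nat => expR (n%:R^-1 * ln c))); last first.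
  by apply/funext => n; rewrite /powR gt_eqF.
suff : (fun n : nat => expR (n%:R^-1 * ln c)) @ \oo --> expR (0 * ln c) by rewrite mul0r expR0.
apply: (@cvg_comp _ _ _ (fun n : nat => n%:R^-1 * ln c) expR); last exact: continuous_expR.
apply: cvgM; last exact: cvg_cst.
by rewrite -cvg_shiftS; exact: cvg_harmonic.
Qed.

(** Write [n = q m + r] with [r < m]: then [b n <= b m ^ q * b r], and [D] absorbs the finitely many
    remainders, its summand 1 making it positive. *)
Lemma fekete_geometric (R : realType) (b : nat -> R) (m : nat) (rho : R) :
  (forall n, 0 <= b n) -> (forall m n, b (m + n)%N <= b m * b n) ->
  (0 < m)%N -> 0 < rho -> b m <= rho ^+ m ->
  exists D, 0 < D /\ forall n, b n <= D * rho ^+ n.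
Proof.
move=> b0 bD m0 r0 bm.
pose D := 1 + \sum_(r < m) b r / rho ^+ r.
have br_ge0 r : 0 <= b r / rho ^+ r by rewrite divr_ge0// exprn_ge0// ltW.
have D0 : 0 < D by rewrite /D ltr_pwDl// sumr_ge0.
exists D; split=> // n.
have bmq q r : b (q * m + r)%N <= rho ^+ (q * m) * b r.
  elim: q => [|q IH]; first by rewrite mul0n expr0 mul1r.
  rewrite mulSn -addnA exprD -mulrA; apply: le_trans (bD _ _) _.
  by apply: ler_pM.
rewrite {1}(divn_eq n m); apply: le_trans (bmq _ _) _.
rewrite [in rho ^+ n](divn_eq n m) exprD mulrCA ler_pM2l ?exprn_gt0//.
rewrite -ler_pdivrMr ?exprn_gt0//.
have nm : (n %% m < m)%N by rewrite ltn_pmod.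
rewrite /D (bigD1 (Ordinal nm))//= addrCA lerDl addr_ge0// sumr_ge0//.
Qed.

(** The limit is the infimum of the roots. From above, a geometric bound of ratio [L + e / 2] gives
    roots at most [D ^ (1 / n) * (L + e / 2)], and [D ^ (1 / n)] tends to 1. *)
Lemma fekete_root (R : realType) (b : nat -> R) :
  (forall n, 0 <= b n) -> (forall m n, b (m + n)%N <= b m * b n) ->
  exists L, (fun n : nat => b n `^ n%:R^-1) @ \oo --> L /\
    forall rho, L < rho -> exists D, 0 < D /\ forall n, b n <= D * rho ^+ n.
Proof.
move=> b0 bD.
pose u (n : nat) := b n `^ n%:R^-1.
(* The index 0 is left out: there the exponent [0^-1] is 0 and the root carries no information on
   [b]. *)
pose E := [set u n | n in [set n | (0 < n)%N]].
have E0 : E !=set0 by exists (u 1%N), 1%N.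
have Elb : lbound E 0 by move=> _ [n _ <-]; exact: powR_ge0.
have Ei : has_inf E by split=> //; exists 0.
pose L := inf E.
have L0 : 0 <= L by apply: lb_le_inf.
have geo rho : L < rho -> exists D, 0 < D /\ forall n, b n <= D * rho ^+ n.
  move=> Lr; have [_ [m m0 <-]] := inf_adherent (ltac:(by rewrite subr_gt0) : 0 < rho - L) Ei.
  rewrite addrC subrK => um.
  have r0 : 0 < rho by apply: le_lt_trans Lr.
  apply: (@fekete_geometric _ _ m) => //.
  have -> : b m = u m ^+ m.
    rewrite /u -powR_mulrn ?powR_ge0// -powRrM mulVf ?powRr1//.
    by rewrite pnatr_eq0 -lt0n.
  by rewrite lerXn2r ?nnegrE ?powR_ge0// ltW.
exists L; split=> //.
apply/cvgrPdist_lt => e e0.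
have [D [D0 hD]] := geo (L + e / 2) ltac:(by rewrite ltrDl divr_gt0).
have : (fun n : nat => D `^ n%:R^-1 * (L + e / 2)) @ \oo --> 1 * (L + e / 2).
  by apply: cvgM; [exact: cvg_root | exact: cvg_cst].
rewrite mul1r => /cvgrPdist_lt /(_ (e / 2) ltac:(by rewrite divr_gt0)) H.
near=> n.
have n0 : (0 < n)%N by near: n; exists 1%N.
have Lu : L <= u n by apply: ge_inf; [exists 0 | exists n].
have r0 : 0 <= L + e / 2 by rewrite addr_ge0// divr_ge0// ltW.
have uD : u n <= D `^ n%:R^-1 * (L + e / 2).
  have Drn : 0 <= D * (L + e / 2) ^+ n by rewrite mulr_ge0 ?exprn_ge0// ltW.
  apply: (@le_trans _ _ ((D * (L + e / 2) ^+ n) `^ n%:R^-1)).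
    by apply: ge0_ler_powR => //; rewrite ?nnegrE ?invr_ge0.
  rewrite powRM ?exprn_ge0 ?(ltW D0)// -powR_mulrn// -powRrM mulfV ?powRr1//.
  by rewrite pnatr_eq0 -lt0n.
have : `|L + e / 2 - D `^ n%:R^-1 * (L + e / 2)| < e / 2 by near: n; exact: H.
rewrite !ltr_norml => /andP[? ?].
by apply/andP; split; rewrite -/(u n); lra.
Unshelve. all: by end_near. Qed.

Lemma mx_entry_le_norm (R : realType) (m n : nat) (A : 'M[R]_(m, n)) i j : `|A i j| <= `|A|.
Proof.
rewrite [leRHS]/Num.norm /= mx_normrE.
exact: (le_bigmax _ (fun ij : 'I_m * 'I_n => `|A ij.1 ij.2|) (i, j)).
Qed.

Lemma mx_norm_le (R : realType) (m n : nat) (A : 'M[R]_(m, n)) c :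
  0 <= c -> (forall i j, `|A i j| <= c) -> `|A| <= c.
Proof.
move=> c0 h; rewrite [leLHS]/Num.norm /= mx_normrE.
by apply: bigmax_le => // -[i j] _; exact: h.
Qed.

Lemma mx_norm_mulmx (R : realType) (n : nat) (A B : 'M[R]_n) :
  `|A *m B| <= n%:R * `|A| * `|B|.
Proof.
apply: mx_norm_le => [|i j]; first by rewrite !mulr_ge0.
rewrite mxE; apply: le_trans (ler_norm_sum _ _ _) _.
rewrite -mulrA mulr_natl -[n in _ *+ n]card_ord -sumr_const.
by apply: ler_sum => l _; rewrite normrM ler_pM ?mx_entry_le_norm.
Qed.

Lemma mx_norm_real_complex (R : realType) (m n : nat) (A : 'M[R]_(m, n)) :
  `|map_mx (real_complex R) A| = (`|A|)%:C.
Proof.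
rewrite [in LHS]/Num.norm [in RHS]/Num.norm /= !mx_normE.
elim/big_ind2: _ => //= [x1 y1 x2 y2|[i j] _].
  by rewrite !num_max => -> ->; rewrite !maxElt ltcR; case: ifP.
by rewrite mxE normc_def /= expr0n addr0 sqrtr_sqr.
Qed.

Lemma map_mxX_complex (R : realType) (q : nat) (C : 'M[R]_q) n :
  map_mx (real_complex R) C ^+ n = map_mx (real_complex R) (C ^+ n).
Proof.
elim: n => [|n IH]; first by rewrite !expr0 map_mx1.
by rewrite !exprS IH -[LHS]map_mxM.
Qed.

Lemma spectral_radius_lt1_cvg0 (R : realType) (q : nat) (C : 'M[R]_q) :
  spectral_radius (map_mx (real_complex R) C) < 1 ->
  forall e, 0 < e -> exists M, forall n, (M <= n)%N -> forall i j, `|(C ^+ n) i j| < e.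
Proof.
case: q C => [|q] C; first by move=> _ e _; exists 0%N => n _ [i hi]; exfalso; move: (hi).
(* The maximum norm is submultiplicative only up to the size of the matrix; this factor repairs it
   and disappears in the limit of the roots. *)
pose b n : R := q.+1%:R * `|C ^+ n|.
have b0 n : 0 <= b n by rewrite mulr_ge0.
have bD m n : b (m + n)%N <= b m * b n.
  rewrite /b exprD -mulrA ler_pM2l ?ltr0n// mulrCA mulrA.
  exact: mx_norm_mulmx.
have [L [uL geo]] := fekete_root b0 bD.
have aL : (fun n : nat => (complex.Re `|map_mx (real_complex R) C ^+ n|) `^ n%:R^-1) @ \oo --> L.
  rewrite (_ : (fun n : nat => _) = (fun n : nat => (q.+1%:R^-1) `^ n%:R^-1 * b n `^ n%:R^-1)).
    by rewrite -[L]mul1r; apply: cvgM => //; apply: cvg_root; rewrite invr_gt0 ltr0n.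
  apply/funext => n; rewrite map_mxX_complex mx_norm_real_complex /=.
  by rewrite -powRM// /b mulKf// pnatr_eq0.
rewrite /spectral_radius (cvg_lim _ aL)// => L1 e e0.
(* The maximum with 1/2 makes [rho] nonnegative whatever the sign of [L]. *)
pose rho := Num.max ((L + 1) / 2) (1 / 2).
have Lrho : L < rho by rewrite /rho lt_max; apply/orP; left; lra.
have rho1 : rho < 1 by rewrite /rho gt_max; apply/andP; split; lra.
have rho0 : 0 <= rho by rewrite /rho le_max; apply/orP; right; lra.
have [D [D0 hD]] := geo _ Lrho.
have := @cvg_geometric R D rho; rewrite ger0_norm// => /(_ rho1).
move=> /cvgrPdist_lt /(_ _ e0) [M _ hM]; exists M => n Mn i j.
have := hM n Mn; rewrite /= sub0r normrN => h.
apply: le_lt_trans h; apply: le_trans (mx_entry_le_norm _ _ _) _.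
apply: le_trans (ler_norm _); apply: le_trans (hD n).
by rewrite /b ler_peMl// ler1n.
Qed.

(** * Matrices in block form *)

(** The real matrix of multiplication by [z] on the plane identified with the complex numbers; at
    [expi theta] it is [rotation theta]. *)
Definition complex_mx (R : realType) (z : R[i]) : 'M[R]_2 :=
  \matrix_(a < 2, b < 2)
    if a == b then complex.Re z else if a == 0 then - complex.Im z else complex.Im z.

(* Keeping this sum folded prevents bigop lemmas from rewriting inside matrix sizes. *)
Definition dsize (k p q : nat) : nat := \sum_(i < k) 2 + p + q.

Definition dsum (R : realType) (k p q : nat) (z : 'I_k -> R[i])
    (B : 'M[R]_p) (C : 'M[R]_q) : 'M[R]_(dsize k p q) :=
  block_mx (block_mx (\mxdiag_(i < k) complex_mx (z i)) 0 0 B) 0 0 C.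

Definition rot_idx (k p q : nat) (i : 'I_k) (a : 'I_2) : 'I_(dsize k p q) :=
  lshift q (lshift p (tagnat.Rank (p_ := fun=> 2%N) i a)).
Definition invol_idx (k p q : nat) (b : 'I_p) : 'I_(dsize k p q) :=
  lshift q (rshift _ b).
Definition contr_idx (k p q : nat) (c : 'I_q) : 'I_(dsize k p q) :=
  rshift _ c.

(** A view on indices: entrywise proofs about block matrices split into nine cases, in which [dsumE]
    computes. *)
Variant idx_spec (k p q : nat) : 'I_(dsize k p q) -> Type :=
| IdxR i a : idx_spec (rot_idx p q i a)
| IdxB b : idx_spec (invol_idx k q b)
| IdxC c : idx_spec (contr_idx k p c).

Lemma idxP (k p q : nat) (x : 'I_(dsize k p q)) : idx_spec x.
Proof.
rewrite -(fintype.splitK x); case: (fintype.split x) => /= [y|c]; last exact: IdxC.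
rewrite -(fintype.splitK y); case: (fintype.split y) => /= [s|b]; last exact: IdxB.
by rewrite -[s]tagnat.sig2K; exact: IdxR.
Qed.

Section dsum_entries.
Variables (R : realType) (k p q : nat) (z : 'I_k -> R[i]) (B : 'M[R]_p) (C : 'M[R]_q).

Lemma dsum_rr i j a b :
  dsum z B C (rot_idx p q i a) (rot_idx p q j b) = if i == j then complex_mx (z i) a b else 0.
Proof.
rewrite /dsum /rot_idx block_mxEul block_mxEul /mxdiag mxE.
rewrite !tagnat.Rank1K; case: eqVneq => [ij|_]; last by rewrite mxE.
rewrite conform_mx_id; congr (complex_mx _ _ _); apply: val_inj; by rewrite tagnat.Rank2K.
Qed.
Lemma dsum_rb i a b : dsum z B C (rot_idx p q i a) (invol_idx k q b) = 0.
Proof. by rewrite /dsum /rot_idx /invol_idx block_mxEul block_mxEur mxE. Qed.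
Lemma dsum_rc i a c : dsum z B C (rot_idx p q i a) (contr_idx k p c) = 0.
Proof. by rewrite /dsum /rot_idx /contr_idx block_mxEur mxE. Qed.
Lemma dsum_br i a b : dsum z B C (invol_idx k q b) (rot_idx p q i a) = 0.
Proof. by rewrite /dsum /rot_idx /invol_idx block_mxEul block_mxEdl mxE. Qed.
Lemma dsum_bb b b' : dsum z B C (invol_idx k q b) (invol_idx k q b') = B b b'.
Proof. by rewrite /dsum /invol_idx block_mxEul block_mxEdr. Qed.
Lemma dsum_bc b c : dsum z B C (invol_idx k q b) (contr_idx k p c) = 0.
Proof. by rewrite /dsum /invol_idx /contr_idx block_mxEur mxE. Qed.
Lemma dsum_cr i a c : dsum z B C (contr_idx k p c) (rot_idx p q i a) = 0.
Proof. by rewrite /dsum /rot_idx /contr_idx block_mxEdl mxE. Qed.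
Lemma dsum_cb c b : dsum z B C (contr_idx k p c) (invol_idx k q b) = 0.
Proof. by rewrite /dsum /invol_idx /contr_idx block_mxEdl mxE. Qed.
Lemma dsum_cc c c' : dsum z B C (contr_idx k p c) (contr_idx k p c') = C c c'.
Proof. by rewrite /dsum /contr_idx block_mxEdr. Qed.

Definition dsumE := (dsum_rr, dsum_rb, dsum_rc, dsum_br, dsum_bb, dsum_bc,
  dsum_cr, dsum_cb, dsum_cc).
End dsum_entries.

Lemma sum_idx (V : nmodType) (k p q : nat) (F : 'I_(dsize k p q) -> V) :
  \sum_x F x = \sum_i \sum_a F (rot_idx p q i a) + \sum_b F (invol_idx k q b) + \sum_c F
    (contr_idx k p c).
Proof.
rewrite big_split_ord big_split_ord /=; congr (_ + _ + _).
rewrite (sig_big_dep xpredT (fun=> xpredT) (fun i a => F (rot_idx p q i a))) /=.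
rewrite (reindex _ (tagnat.sig_bij_on (p_ := fun=> 2%N))) /=.
by apply: eq_bigr => s _; rewrite /rot_idx tagnat.sig2K.
Qed.

Lemma ord2P (P : 'I_2 -> Prop) : P 0 -> P 1 -> forall a, P a.
Proof.
move=> P0 P1 [[|[|//]] h]; first by rewrite (_ : Ordinal h = 0)//; apply: val_inj.
by rewrite (_ : Ordinal h = 1)//; apply: val_inj.
Qed.

Lemma complex_mxM (R : realType) (z w : R[i]) : complex_mx z *m complex_mx w = complex_mx (z * w).
Proof.
case: z w => a b [c d]; apply/matrixP; apply: ord2P; apply: ord2P;
  rewrite !mxE big_ord_recl big_ord1 !mxE /=; ring.
Qed.

Lemma complex_mxZ (R : realType) (c : R) (z : R[i]) : c *: complex_mx z = complex_mx (c%:C * z).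
Proof.
case: z => a b; apply/matrixP; apply: ord2P; apply: ord2P; rewrite !mxE /=; ring.
Qed.

Lemma complex_mx1 (R : realType) : complex_mx (1 : R[i]) = 1%:M.
Proof.
apply/matrixP; apply: ord2P; apply: ord2P; rewrite !mxE //= oppr0 //.
Qed.

Section dsum_algebra.
Variables (R : realType) (k p q : nat).
Implicit Types (z w : 'I_k -> R[i]) (B : 'M[R]_p) (C : 'M[R]_q).

Lemma dsumM z w B B' C C' :
  dsum z B C *m dsum w B' C' = dsum (fun i => z i * w i) (B *m B') (C *m C').
Proof.
apply/matrixP => x y; rewrite mxE sum_idx.
case: (idxP x) => [i a|b|c]; case: (idxP y) => [j a'|b'|c']; rewrite !dsumE.
- rewrite (bigD1 i)//= [X in _ + X + _ + _]big1 ?addr0 => [|i' i'i]; last first.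
    by rewrite big1// => a'' _; rewrite !dsumE eq_sym (negbTE i'i) mul0r.
  rewrite [X in _ + X + _]big1 ?addr0 => [|b _]; last by rewrite !dsumE mul0r.
  rewrite [X in _ + X]big1 ?addr0 => [|c _]; last by rewrite !dsumE mul0r.
  have [<-|ij] := eqVneq i j; last first.
    by rewrite big1// => a'' _; rewrite !dsumE (negbTE ij) mulr0.
  by rewrite -complex_mxM mxE; apply: eq_bigr => a'' _; rewrite !dsumE !eqxx.
- rewrite big1 ?add0r => [|i' _]; last by rewrite big1// => a'' _; rewrite !dsumE mulr0.
  rewrite big1 ?add0r => [|b _]; last by rewrite !dsumE mul0r.
  by rewrite big1// => c _; rewrite !dsumE mul0r.
- rewrite big1 ?add0r => [|i' _]; last by rewrite big1// => a'' _; rewrite !dsumE mulr0.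
  rewrite big1 ?add0r => [|b _]; last by rewrite !dsumE mul0r.
  by rewrite big1// => c _; rewrite !dsumE mul0r.
- rewrite big1 ?add0r => [|i' _]; last by rewrite big1// => a'' _; rewrite !dsumE mul0r.
  rewrite big1 ?add0r => [|b' _]; last by rewrite !dsumE mulr0.
  by rewrite big1// => c _; rewrite !dsumE mul0r.
- rewrite big1 ?add0r => [|i' _]; last by rewrite big1// => a'' _; rewrite !dsumE mul0r.
  rewrite [X in _ + X]big1 ?addr0 => [|c _]; last by rewrite !dsumE mul0r.
  by rewrite mxE; apply: eq_bigr => b'' _; rewrite !dsumE.
- rewrite big1 ?add0r => [|i' _]; last by rewrite big1// => a'' _; rewrite !dsumE mul0r.
  rewrite big1 ?add0r => [|b' _]; last by rewrite !dsumE mulr0.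
  by rewrite big1// => c _; rewrite !dsumE mul0r.
- rewrite big1 ?add0r => [|i' _]; last by rewrite big1// => a'' _; rewrite !dsumE mul0r.
  rewrite big1 ?add0r => [|b' _]; last by rewrite !dsumE mul0r.
  by rewrite big1// => c' _; rewrite !dsumE mulr0.
- rewrite big1 ?add0r => [|i' _]; last by rewrite big1// => a'' _; rewrite !dsumE mul0r.
  rewrite big1 ?add0r => [|b'' _]; last by rewrite !dsumE mul0r.
  by rewrite big1// => c'' _; rewrite !dsumE mulr0.
- rewrite big1 ?add0r => [|i' _]; last by rewrite big1// => a'' _; rewrite !dsumE mul0r.
  rewrite big1 ?add0r => [|b _]; last by rewrite !dsumE mul0r.
  by rewrite mxE; apply: eq_bigr => c'' _; rewrite !dsumE.
Qed.
End dsum_algebra.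

Section dsum_algebra2.
Variables (R : realType) (k p q : nat).
Implicit Types (z w : 'I_k -> R[i]) (B : 'M[R]_p) (C : 'M[R]_q).

Lemma eq_dsum z w B C : z =1 w -> dsum z B C = dsum w B C.
Proof. by move=> /funext ->. Qed.

Lemma dsumZ (c : R) z B C :
  c *: dsum z B C = dsum (fun i => c%:C * z i) (c *: B) (c *: C).
Proof.
apply/matrixP => x y; rewrite mxE.
case: (idxP x) => [i a|b|d]; case: (idxP y) => [j a'|b'|d']; rewrite !dsumE ?mulr0//.
- by case: eqP => [_|_]; rewrite ?mulr0// -complex_mxZ [in RHS]mxE.
- by rewrite mxE.
- by rewrite mxE.
Qed.

Lemma dsum1 : dsum (fun=> 1) 1%:M 1%:M = 1%:M :> 'M[R]_(dsize k p q).
Proof.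
rewrite /dsum (eq_mxdiag (B'_ := fun=> 1%:M)) => [|i]; last exact: complex_mx1.
by rewrite (mxdiagZ (p_ := fun=> 2%N)) -!scalar_mx_block.
Qed.

Lemma dsumX z B C n :
  dsum z B C ^+ n = dsum (fun i => z i ^+ n) (B ^+ n) (C ^+ n).
Proof.
elim: n => [|n IH]; first by rewrite !expr0 -[LHS]dsum1; apply: eq_dsum => i; rewrite expr0.
by rewrite !exprS IH -[LHS]/(dsum z B C *m _) dsumM; apply: eq_dsum => i; rewrite exprS.
Qed.

(* Vectors and matrices read in the complex coordinates [x_0 + i x_1] of the 2x2 blocks. *)
Definition rot_coord (x : 'cV[R]_(dsize k p q)) (i : 'I_k) : R[i] :=
  x (rot_idx p q i 0) 0 +i* x (rot_idx p q i 1) 0.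

Definition rot_entry (A : 'M[R]_(dsize k p q)) (i : 'I_k) : R[i] :=
  A (rot_idx p q i 0) (rot_idx p q i 0) +i* A (rot_idx p q i 1) (rot_idx p q i 0).
Definition invol_block (A : 'M[R]_(dsize k p q)) : 'M[R]_p := \matrix_(b,
  b') A (invol_idx k q b) (invol_idx k q b').
Definition contr_block (A : 'M[R]_(dsize k p q)) : 'M[R]_q := \matrix_(c,
  c') A (contr_idx k p c) (contr_idx k p c').

Lemma rot_entry_dsum z B C i : rot_entry (dsum z B C) i = z i.
Proof. by rewrite /rot_entry !dsumE eqxx !mxE /=; case: (z i). Qed.
Lemma invol_block_dsum z B C : invol_block (dsum z B C) = B.
Proof. by apply/matrixP => b b'; rewrite mxE dsumE. Qed.
Lemma contr_block_dsum z B C : contr_block (dsum z B C) = C.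
Proof. by apply/matrixP => b b'; rewrite mxE dsumE. Qed.

Lemma rot_coord_dsum z B C x i : rot_coord (dsum z B C *m x) i = z i * rot_coord x i.
Proof.
have h a : (dsum z B C *m x) (rot_idx p q i a) 0 = \sum_a' complex_mx (z i) a a' * x (rot_idx p
  q i a') 0.
  rewrite mxE sum_idx (bigD1 i)//= [X in _ + X + _ + _]big1 ?addr0 => [|i' i'i]; last first.
    by rewrite big1// => a'' _; rewrite !dsumE eq_sym (negbTE i'i) mul0r.
  rewrite [X in _ + X + _]big1 ?addr0 => [|b _]; last by rewrite !dsumE mul0r.
  rewrite [X in _ + X]big1 ?addr0 => [|c _]; last by rewrite !dsumE mul0r.
  apply: eq_bigr => a' _. by rewrite !dsumE eqxx.
rewrite /rot_coord !h !big_ord_recl !big_ord0 !mxE /= !addr0.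
rewrite (_ : lift ord0 ord0 = 1); last exact: val_inj.
rewrite -[ord0]/(0 : 'I_2).
move: (x _ 0) (x _ 0) => x0 x1; case: (z i) => u v /=.
by apply/eqP; rewrite eq_complex /=; apply/andP; split; apply/eqP; ring.
Qed.

End dsum_algebra2.

(** * Closed conditions satisfied by the closure of the orbit *)

(** The set where [f - g <= 0] is closed by continuity. Inequalities and identities pass from the
    powers of [T] to their limits in this way. *)
Lemma closure_le_fun (R : realType) (V : topologicalType) (X : set V) (f g : V -> R) :
  continuous f -> continuous g -> (forall A, X A -> f A <= g A) ->
  forall A, closure X A -> f A <= g A.
Proof.
move=> cf cg h A XA.
pose D := [set A | f A - g A <= 0].
have Dc : closed D.
  apply: (preimage_closed (f := fun A => f A - g A) _ (@closed_le R 0)) => B _.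
  by apply: continuousB; [exact: cf | exact: cg].
have : closure D A by apply: closureS XA => B XB; rewrite /D /= subr_le0 h.
by rewrite -(proj1 (closure_id D) Dc) /D /= subr_le0.
Qed.

Lemma closure_eq_fun (R : realType) (V : topologicalType) (X : set V) (f g : V -> R) :
  continuous f -> continuous g -> (forall A, X A -> f A = g A) ->
  forall A, closure X A -> f A = g A.
Proof.
move=> cf cg h A XA; apply/eqP; rewrite eq_le.
by rewrite (closure_le_fun cf cg _ XA) ?(closure_le_fun cg cf _ XA)// => B /h ->.
Qed.

Lemma continuous_mul (R : realType) (V : topologicalType) (f g : V -> R) :
  continuous f -> continuous g -> continuous (fun x => f x * g x).
Proof. by move=> cf cg x; apply: cvgM; [exact: cf | exact: cg]. Qed.

Lemma continuous_norm (R : realType) (V : topologicalType) (f : V -> R) :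
  continuous f -> continuous (fun x => `|f x|).
Proof. by move=> cf x; apply: cvg_norm; exact: cf. Qed.

(** * Continuity of complex-valued functions *)

Section complex_continuity.
Variables (R : realType) (V : topologicalType).
Implicit Types f g : V -> R[i].

(** Stated on real and imaginary parts, so that closure arguments reduce to real-valued
    functions. *)
Definition ccontinuous f :=
  continuous (fun x => complex.Re (f x)) /\ continuous (fun x => complex.Im (f x)).

Lemma ccontM f g : ccontinuous f -> ccontinuous g -> ccontinuous (fun x => f x * g x).
Proof.
move=> [f1 f2] [g1 g2].
have e1 x : complex.Re (f x * g x) = complex.Re (f x) * complex.Re (g x) - complex.Im (f x) *
  complex.Im (g x).
  by case: (f x) (g x) => ? ? [].
have e2 x : complex.Im (f x * g x) = complex.Re (f x) * complex.Im (g x) + complex.Im (f x) *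
  complex.Re (g x).
  by case: (f x) (g x) => ? ? [].
split=> x; [rewrite (funext e1) | rewrite (funext e2)].
  by apply: cvgB; apply: cvgM; [exact: f1 | exact: g1 | exact: f2 | exact: g2].
by apply: cvgD; apply: cvgM; [exact: f1 | exact: g2 | exact: f2 | exact: g1].
Qed.

Lemma ccont_conj f : ccontinuous f -> ccontinuous (fun x => conjc (f x)).
Proof.
move=> [f1 f2].
have e1 x : complex.Re (conjc (f x)) = complex.Re (f x) by case: (f x).
have e2 x : complex.Im (conjc (f x)) = - complex.Im (f x) by case: (f x).
split=> x; [rewrite (funext e1) | rewrite (funext e2)]; first exact: f1.
by apply: cvgN; exact: f2.
Qed.

Lemma ccont_cst (c : R[i]) : ccontinuous (fun=> c).
Proof. by split=> x; exact: cst_continuous. Qed.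

Lemma ccontX f n : ccontinuous f -> ccontinuous (fun x => f x ^+ n).
Proof.
move=> cf; elim: n => [|n IH]; first exact: ccont_cst.
by under eq_fun do rewrite exprS; exact: ccontM.
Qed.

Lemma ccont_prod (I : finType) (F : I -> V -> R[i]) :
  (forall i, ccontinuous (F i)) -> ccontinuous (fun x => \prod_i F i x).
Proof.
move=> cF.
suff : forall s : seq I, ccontinuous (fun x => \prod_(i <- s) F i x) by apply.
elim=> [|i s IH].
  by under eq_fun do rewrite big_nil; exact: ccont_cst.
by under eq_fun do rewrite big_cons; exact: ccontM.
Qed.

Lemma closure_ceq_fun (X : set V) f g :
  ccontinuous f -> ccontinuous g -> (forall A, X A -> f A = g A) ->
  forall A, closure X A -> f A = g A.
Proof.
move=> [f1 f2] [g1 g2] h A XA.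
have e1 := closure_eq_fun f1 g1 (fun A XA => congr1 _ (h A XA)) XA.
have e2 := closure_eq_fun f2 g2 (fun A XA => congr1 _ (h A XA)) XA.
by apply/eqP; rewrite eq_complex e1 e2 !eqxx.
Qed.

End complex_continuity.

Lemma conjcM (R : realType) (z w : R[i]) : conjc (z * w) = conjc z * conjc w.
Proof. exact: (rmorphM (@conjc R)). Qed.

Lemma conjcD (R : realType) (z w : R[i]) : conjc (z + w) = conjc z + conjc w.
Proof. exact: (rmorphD (@conjc R)). Qed.

(** The modulus with values in [R], whereas the norm of [R[i]] takes its values in [R[i]]. *)
Definition cnorm (R : realType) (z : R[i]) : R :=
  Num.sqrt (complex.Re z * complex.Re z + complex.Im z * complex.Im z).

Lemma cnormM (R : realType) (z w : R[i]) : cnorm (z * w) = cnorm z * cnorm w.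
Proof.
rewrite /cnorm -sqrtrM ?addr_ge0 -?expr2 ?sqr_ge0//; congr Num.sqrt.
by case: z w => ? ? [? ?] /=; ring.
Qed.

Lemma cnorm_expi (R : realType) (x : R) : cnorm (expi x) = 1.
Proof. by rewrite /cnorm /expi /= -!expr2 cos2Dsin2 sqrtr1. Qed.

Lemma cnorm_real (R : realType) (x : R) : cnorm x%:C = `|x|.
Proof. by rewrite /cnorm /= mulr0 addr0 -expr2 sqrtr_sqr. Qed.

Lemma ccont_cnorm (R : realType) (V : topologicalType) (f : V -> R[i]) :
  ccontinuous f -> continuous (fun x => cnorm (f x)).
Proof.
move=> [f1 f2] x.
apply: (@continuous_comp _ _ _ (fun x =>
  complex.Re (f x) * complex.Re (f x) + complex.Im (f x) * complex.Im (f x)) Num.sqrt).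
  by apply: cvgD; apply: cvgM; [exact: f1 | exact: f1 | exact: f2 | exact: f2].
exact: sqrt_continuous.
Qed.

Lemma entry_continuous (R : realType) (m n : nat) i j : continuous (fun A : 'M[R]_(m, n) =>
  A i j : R).
Proof. exact: coord_continuous. Qed.

Lemma ccont_complex_mx (R : realType) (V : topologicalType) (f : V -> R[i]) a b :
  ccontinuous f -> continuous (fun x => complex_mx (f x) a b : R).
Proof.
move=> [fr fi].
rewrite (_ : (fun x => _) = fun x => if a == b then complex.Re (f x)
    else if a == 0 then - complex.Im (f x) else complex.Im (f x)); last first.
  by apply/funext => x; rewrite mxE.
case: (a == b); first exact: fr.
case: (a == 0); last exact: fi.
by move=> x; apply: cvgN; exact: fi.
Qed.

Lemma conjcZ (R : realType) (c : R) (z : R[i]) : conjc (c%:C * z) = c%:C * conjc z.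
Proof.
by case: z => a b; apply/eqP; rewrite eq_complex /=; apply/andP; split; apply/eqP; ring.
Qed.

Section closure_facts.
Variables (R : realType) (k p q : nat) (theta : 'I_k -> R) (B : 'M[R]_p) (C : 'M[R]_q).
Let T : 'M[R]_(dsize k p q) := dsum (fun i => expi (theta i)) B C.
Hypothesis hB : B ^+ 2 = 1%:M.

Lemma rotX n : T ^+ n = dsum (fun i => expi (n%:R * theta i)) (B ^+ n) (C ^+ n).
Proof. by rewrite dsumX; apply: eq_dsum => i; rewrite expiM_nat. Qed.

Lemma rotZX c n : c *: T ^+ n =
  dsum (fun i => c%:C * expi (n%:R * theta i)) (c *: B ^+ n) (c *: C ^+ n).
Proof. by rewrite rotX dsumZ. Qed.

Lemma involX n : B ^+ n = B ^+ (odd n).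
Proof.
rewrite -{1}(odd_double_half n) exprD -mul2n exprM hB.
by rewrite -[1%:M]/(1 : 'M[R]_p) expr1n mulr1.
Qed.

Lemma ccont_rot_entry i : ccontinuous (fun A : 'M[R]_(dsize k p q) => rot_entry A i).
Proof.
split; [exact (@entry_continuous R _ _ (rot_idx p q i 0) (rot_idx p q i 0))|].
exact (@entry_continuous R _ _ (rot_idx p q i 1) (rot_idx p q i 0)).
Qed.

(** Both sides have continuous entries and agree on scaled powers. So limits keep the block shape
    and stay complex linear on each plane. *)
Lemma closure_dsum A : closure (ROrb T) A ->
  A = dsum (rot_entry A) (invol_block A) (contr_block A).
Proof.
move=> TA; apply/matrixP => x y.
pose f (A : 'M[R]_(dsize k p q)) : R := A x y.
pose g (A : 'M[R]_(dsize k p q)) : R := dsum (rot_entry A) (invol_block A) (contr_block A) x y.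
apply: (@closure_eq_fun _ _ (ROrb T) f g) TA; rewrite /f /g.
- exact: entry_continuous.
- case: (idxP x) => [i a|b|c]; case: (idxP y) => [j a'|b'|c'].
  all: try by under eq_fun do rewrite dsumE; exact: cst_continuous.
  + rewrite (_ : (fun A => _) = fun A => if i == j then complex_mx (rot_entry A i) a a' else 0);
    last first.
      by apply/funext => D; rewrite dsumE.
    case: eqP => _; last by exact: cst_continuous.
    exact: (ccont_complex_mx (ccont_rot_entry i)).
  + rewrite (_ : (fun A => _) = fun A : 'M[R]_(dsize k p q) =>
    A (invol_idx k q b) (invol_idx k q b')).
      exact: entry_continuous.
    by apply/funext => D; rewrite dsumE mxE.
  + rewrite (_ : (fun A => _) = fun A : 'M[R]_(dsize k p q) =>
    A (contr_idx k p c) (contr_idx k p c')).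
      exact: entry_continuous.
    by apply/funext => D; rewrite dsumE mxE.
- move=> _ [c _ [n _ <-]]; rewrite rotZX invol_block_dsum contr_block_dsum.
  rewrite (_ : rot_entry (dsum _ _ _) = fun i => c%:C * expi (n%:R * theta i))//.
  by apply/funext => i; exact: rot_entry_dsum.
Qed.

(** On [c *: T ^+ n] both sides equal [c ^+ 2], and the identity is closed. *)
Lemma closure_rot_entry_norm A i j : closure (ROrb T) A ->
  rot_entry A i * conjc (rot_entry A i) = rot_entry A j * conjc (rot_entry A j).
Proof.
move: A; apply: (@closure_ceq_fun _ _ (ROrb T) (fun A => rot_entry A i * conjc (rot_entry A i))
  (fun A => rot_entry A j * conjc (rot_entry A j))).
- by apply: ccontM; [|apply: ccont_conj]; exact: ccont_rot_entry.
- by apply: ccontM; [|apply: ccont_conj]; exact: ccont_rot_entry.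
move=> {}A [c _ [n _ <-]]; rewrite rotZX !rot_entry_dsum !rmorphM /=.
by rewrite mulrACA expi_mulJ [RHS]mulrACA expi_mulJ.
Qed.

(* Squaring makes the relation insensitive to the real factor of an element of [ROrb T],
   as both sides scale in the same way. *)
Lemma closure_rel A (s : 'I_k -> int) (t : int) :
  \sum_j (s j)%:~R * theta j = 2 * pi * t%:~R ->
  closure (ROrb T) A ->
  (\prod_j (if 0 <= s j then rot_entry A j else conjc (rot_entry A j)) ^+ absz (s j)) ^+ 2 =
  \prod_j (rot_entry A j * conjc (rot_entry A j)) ^+ absz (s j).
Proof.
move=> st; pose w (A : 'M[R]_(dsize k p q)) j :=
  if 0 <= s j then rot_entry A j else conjc (rot_entry A j).
apply: (@closure_ceq_fun _ _ (ROrb T) (fun A => (\prod_j w A j ^+ absz (s j)) ^+ 2)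
  (fun A => \prod_j (rot_entry A j * conjc (rot_entry A j)) ^+ absz (s j))).
- apply: ccontX; apply: ccont_prod => j; apply: ccontX; rewrite /w.
  by case: (0 <= s j); [|apply: ccont_conj]; exact: ccont_rot_entry.
- apply: ccont_prod => j; apply: ccontX.
  by apply: ccontM; [|apply: ccont_conj]; exact: ccont_rot_entry.
move=> {}A [c _ [n _ <-]]; rewrite /w.
pose z j := c%:C * expi (n%:R * theta j).
rewrite (_ : rot_entry (c *: T ^+ n) = z); last by apply/funext => j;
  rewrite rotZX rot_entry_dsum.
(* Conjugation turns [expi x] into [expi (- x)] and fixes the real factor, so both signs of [s j]
   give the same formula. *)
have wE j : (if 0 <= s j then z j else conjc (z j)) ^+ `|s j| =
    c%:C ^+ `|s j| * expi (n%:R * ((s j)%:~R * theta j)).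
  have [sj|sj] := lerP 0 (s j).
    have -> : (s j)%:~R = (absz (s j))%:R :> R by rewrite -{1}(gez0_abs sj).
    by rewrite exprMn -expiM_nat mulrCA.
  have -> : (s j)%:~R = - (absz (s j))%:R :> R.
    by rewrite -{1}[s j]opprK -(ltz0_abs sj) mulrNz.
  by rewrite conjcZ -expiN exprMn -expiM_nat; congr (_ * expi _); ring.
rewrite (eq_bigr _ (fun j _ => wE j)) big_split /= -expi_sum -mulr_sumr st exprMn -expiM_nat.
have -> : 2%:R * (n%:R * (2 * pi * t%:~R)) = 2 * pi * (2 * n%:Z * t)%:~R :> R.
  by rewrite !intrM; ring.
have zJ j : (z j * conjc (z j)) ^+ `|s j| = (c%:C ^+ `|s j|) ^+ 2.
  by rewrite /z conjcZ mulrACA expi_mulJ mulr1 -expr2 -!exprM mulnC.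
by rewrite expi_2pi_int mulr1 -prodrXl (eq_bigr _ (fun j _ => zJ j)).
Qed.
End closure_facts.

(** * Limits of scaled powers that are not scaled powers *)

Section closure_structure.
Variables (R : realType) (k p q : nat) (theta : 'I_k -> R) (B : 'M[R]_p) (C : 'M[R]_q).
Let T : 'M[R]_(dsize k p q) := dsum (fun i => expi (theta i)) B C.
Hypothesis hB : B ^+ 2 = 1%:M.
Hypothesis hC : forall e, 0 < e -> exists M, forall n, (M <= n)%N -> forall i j,
  `|(C ^+ n) i j| < e.
Variable i0 : 'I_k.

Definition power_line n : set 'M[R]_(dsize k p q) := [set c *: T ^+ n | c in [set: R]].

(** The line is closed because the scalar is a continuous function of the matrix: it is read off
    from the rotation block [i0]. *)
Lemma closure_power_line n A : closure (power_line n) A -> exists c, A = c *: T ^+ n.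
Proof.
pose coef (A : 'M[R]_(dsize k p q)) :=
  complex.Re (rot_entry A i0 * conjc (expi (n%:R * theta i0))).
have ccoef : continuous coef.
  by have [] := ccontM (@ccont_rot_entry R k p q i0) (ccont_cst _ (conjc (expi (n%:R * theta
    i0)))).
move=> nA; exists (coef A); apply/matrixP => x y; rewrite mxE.
pose f (A : 'M[R]_(dsize k p q)) : R := A x y.
pose g (A : 'M[R]_(dsize k p q)) : R := coef A * (T ^+ n) x y.
apply: (@closure_eq_fun _ _ (power_line n) f g) nA; rewrite /f /g.
- exact: entry_continuous.
- apply: (@continuous_mul R _ coef (fun=> (T ^+ n) x y)) => //; exact: cst_continuous.
- move=> _ [c _ <-]; rewrite mxE; congr (_ * _).
  by rewrite /coef rotZX rot_entry_dsum -mulrA expi_mulJ mulr1.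
Qed.

Definition power_tail n0 : set 'M[R]_(dsize k p q) :=
  [set c *: T ^+ n | c in [set: R] & n in [set n | (n0 <= n)%N]].

(** Such an [A] lies in the closure of no line of multiples of one power, so these lines can be
    removed one after the other from the set approximating [A]. *)
Lemma closure_power_tail A : closure (ROrb T) A -> (forall c n, A <> c *: T ^+ n) ->
  forall n0, closure (power_tail n0) A.
Proof.
move=> TA nA; elim=> [|n IH].
  by apply: closureS TA => _ [c _ [n _ <-]]; exists c => //; exists n.
have : closure (power_line n `|` power_tail n.+1) A.
  apply: closureS IH => _ [c _ [m /= nm <-]].
  move: nm; rewrite leq_eqVlt => /orP[/eqP ->|nm]; first by left; exists c.
  by right; exists c => //; exists m.
by rewrite closureU => -[/closure_power_line[c /nA]|].
Qed.

Lemma cnorm_rotZX c n : cnorm (rot_entry (c *: T ^+ n) i0) = `|c|.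
Proof. by rewrite rotZX rot_entry_dsum cnormM cnorm_real cnorm_expi mulr1. Qed.

(** On a far enough tail the entries of [c *: C ^+ n] are at most [e |c|], and [|c|] is the modulus
    of the rotation entry [i0]. This bound survives in the limit for every positive [e]. *)
Lemma closure_contr_block A : closure (ROrb T) A -> (forall c n, A <> c *: T ^+ n) ->
  contr_block A = 0.
Proof.
move=> TA nA; apply/matrixP => a b; rewrite !mxE.
have cn : continuous (fun A : 'M[R]_(dsize k p q) => cnorm (rot_entry A i0)).
  by apply: ccont_cnorm; exact: ccont_rot_entry.
suff h e : 0 < e -> `|A (contr_idx k p a) (contr_idx k p b)| <= e * cnorm (rot_entry A i0).
  apply/eqP; rewrite -normr_eq0; apply/eqP/le_anti; rewrite normr_ge0 andbT.
  apply/ler_addgt0Pr => e e0; rewrite add0r.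
  have c0 : 0 <= cnorm (rot_entry A i0) by exact: sqrtr_ge0.
  have c1 : 0 < cnorm (rot_entry A i0) + 1 by rewrite ltr_wpDl.
  apply: le_trans (h (e / (cnorm (rot_entry A i0) + 1)) _) _; first by rewrite divr_gt0.
  rewrite -mulrA ger_pMr// ler_pdivrMl// mulr1; lra.
move=> e0; have [M hM] := hC e0.
pose f (A : 'M[R]_(dsize k p q)) : R := `|A (contr_idx k p a) (contr_idx k p b)|.
pose g (A : 'M[R]_(dsize k p q)) : R := e * cnorm (rot_entry A i0).
apply: (@closure_le_fun _ _ (power_tail M) f g) (closure_power_tail TA nA M); rewrite /f /g.
- by apply: continuous_norm; exact: entry_continuous.
- apply: (@continuous_mul R _ (fun=> e)) => //; exact: cst_continuous.
- move=> _ [c _ [n Mn <-]]; rewrite cnorm_rotZX rotZX dsumE mxE normrM mulrC.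
  by rewrite ler_wpM2r// ltW// hM.
Qed.

(** The sign of [c] and the parity of [n] cut the orbit into four pieces, on each of which the
    identity is closed; the closure of a finite union is the union of the closures. *)
Lemma closure_invol_block A : closure (ROrb T) A ->
  exists sg par : bool, invol_block A = ((-1) ^+ sg * cnorm (rot_entry A i0)) *: B ^+ par.
Proof.
pose X (sg par : bool) : set 'M[R]_(dsize k p q) :=
  [set c *: T ^+ n | c in [set c : R | c = (-1) ^+ sg * `|c|] & n in [set n | odd n = par]].
have Xc sg par A' : closure (X sg par) A' ->
  invol_block A' = ((-1) ^+ sg * cnorm (rot_entry A' i0)) *: B ^+ par.
  move=> XA; apply/matrixP => b b'; rewrite !mxE.
  pose f (A : 'M[R]_(dsize k p q)) : R := A (invol_idx k q b) (invol_idx k q b').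
  pose g (A : 'M[R]_(dsize k p q)) : R := (-1) ^+ sg * cnorm (rot_entry A i0) * (B ^+ par) b b'.
  apply: (@closure_eq_fun _ _ (X sg par) f g) XA; rewrite /f /g.
  - exact: entry_continuous.
  - have cn : continuous (fun A : 'M[R]_(dsize k p q) => cnorm (rot_entry A i0)).
      by apply: ccont_cnorm; exact: ccont_rot_entry.
    apply: (@continuous_mul R _ _ (fun=> (B ^+ par) b b')); last exact: cst_continuous.
    by apply: (@continuous_mul R _ (fun=> (-1) ^+ sg)) => //; exact: cst_continuous.
  - move=> _ [c /= cs [n <- <-]]; rewrite cnorm_rotZX -cs rotZX dsumE mxE.
    by rewrite (involX hB n).
move=> TA.
have : closure ((X false false `|` X false true) `|` (X true false `|` X true true)) A.
  apply: closureS TA => _ [c _ [n _ <-]].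
  have XX (sg : bool) : c = (-1) ^+ sg * `|c| -> (X sg false `|` X sg true) (c *: T ^+ n).
    move=> csg; case e: (odd n); [right|left]; exists c => //; exists n => //.
  have [c0|c0] := leP 0 c.
    by left; apply: XX; rewrite mul1r ger0_norm.
  by right; apply: XX; rewrite expr1 mulN1r ltr0_norm// opprK.
rewrite !closureU => -[[]|[]] /Xc e; [exists false, false|exists false, true|
  exists true, false| exists true, true]; exact: e.
Qed.
End closure_structure.

(** * Compactness *)

Lemma mx_continuous (V R : topologicalType) (m n : nat) (f : V -> 'M[R]_(m, n)) :
  (forall i j, continuous (fun x => f x i j : R)) -> continuous f.
Proof.
move=> cf x U [P hP hU]; rewrite /nbhs /=.
have : \forall y \near x, forall i, forall j, P i j (f y i j).
  apply: filter_forall => i; apply: filter_forall => j.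
  exact: (cf i j x _ (hP i j)).
by apply: filterS => y hy; apply: hU.
Qed.

Lemma continuous_sum (R : realType) (V : topologicalType) (I : finType) (F : I -> V -> R) :
  (forall i, continuous (F i)) -> continuous (fun x => \sum_i F i x).
Proof.
move=> cF.
suff : forall s : seq I, continuous (fun x => \sum_(i <- s) F i x) by apply.
elim=> [|i s IH].
  rewrite (_ : (fun x => _) = fun=> 0); first exact: cst_continuous.
  by apply/funext => x; rewrite big_nil.
rewrite (_ : (fun x => _) = fun x => F i x + \sum_(i <- s) F i x).
  by move=> x; apply: cvgD; [exact: cF | exact: IH].
by apply/funext => x; rewrite big_cons.
Qed.

Lemma mulmxl_continuous (R : realType) (m n l : nat) (x : 'M[R]_(n, l)) :
  continuous (fun A : 'M[R]_(m, n) => A *m x).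
Proof.
apply: mx_continuous => i j.
rewrite (_ : (fun A => _) = fun A : 'M[R]_(m, n) => \sum_s A i s * x s j); last first.
  by apply/funext => A; rewrite mxE.
apply: continuous_sum => s; apply: (@continuous_mul R _ _ (fun=> x s j)).
  exact: entry_continuous.
exact: cst_continuous.
Qed.

(** The set is the continuous image under [vec_mx] of a compact box of row vectors. *)
Lemma mx_bounded_compact (R : realType) (m n : nat) (M : R) :
  compact [set A : 'M[R]_(m, n) | forall i j, `|A i j| <= M].
Proof.
have h := @rV_compact R (m * n) (fun=> `[- M, M]%classic) (fun=> @segment_compact R _ _).
have cv : continuous (vec_mx : 'rV[R]_(m * n) -> 'M[R]_(m, n)).
  apply: mx_continuous => i j.
  rewrite (_ : (fun v => _) = fun v : 'rV[R]_(m * n) => v 0 (mxvec_index i j)).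
    exact: entry_continuous.
  by apply/funext => v; rewrite mxE.
have := continuous_compact (continuous_subspaceT cv) h; congr compact.
apply/seteqP; split=> [_ [v hv <-] i j /=|A hA].
  by rewrite mxE; have := hv (mxvec_index i j); rewrite /= in_itv /= ler_norml.
exists (mxvec A); last exact: mxvecK.
by move=> s /=; case/mxvec_indexP: s => i j; rewrite mxvecE in_itv /= -ler_norml.
Qed.

(** A bounded [X] has compact closure, whose image under evaluation at [x] is compact, hence
    closed. *)
Lemma closure_image_mulmx (R : realType) (m n l : nat) (X : set 'M[R]_(m, n))
    (x : 'M[R]_(n, l)) (y : 'M[R]_(m, l)) (M : R) :
  (forall A, X A -> forall i j, `|A i j| <= M) ->
  closure [set A *m x | A in X] y -> exists2 A, closure X A & y = A *m x.
Proof.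
move=> hM hy.
have cX : compact (closure X).
  apply: (subclosed_compact (@closed_closure _ X) (@mx_bounded_compact R m n M)) => A XA i j.
  pose f (A : 'M[R]_(m, n)) : R := `|A i j|.
  apply: (@closure_le_fun _ _ X f (fun=> M)) XA.
  - by apply: continuous_norm; exact: entry_continuous.
  - exact: cst_continuous.
  - by move=> A' XA'; exact: hM.
have cI : closed [set A *m x | A in closure X].
  apply: compact_closed; first exact: norm_hausdorff.
  apply: continuous_compact => //; apply: continuous_subspaceT; exact: mulmxl_continuous.
have : closure [set A *m x | A in closure X] y.
  by apply: closureS hy => _ [A XA <-]; exists A => //; exact: subset_closure.
by rewrite -(proj1 (closure_id _) cI) => -[A XA <-]; exists A.
Qed.

Lemma image_closure_mulmx (R : realType) (m n l : nat) (X : set 'M[R]_(m, n))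
    (x : 'M[R]_(n, l)) A :
  closure X A -> closure [set A *m x | A in X] (A *m x).
Proof.
move=> XA U hU; have [A' [XA' UA']] := XA _ (mulmxl_continuous hU).
by exists (A' *m x); split=> //; exists A'.
Qed.

(** * Vectorwise attainment and block shape in the reflexive hull *)

Section reflexive_cover.
Variables (R : realType) (k p q : nat) (theta : 'I_k -> R) (B : 'M[R]_p) (C : 'M[R]_q).
Let T : 'M[R]_(dsize k p q) := dsum (fun i => expi (theta i)) B C.
Hypothesis hB : B ^+ 2 = 1%:M.
Hypothesis hC : forall e, 0 < e -> exists M, forall n, (M <= n)%N -> forall i j,
  `|(C ^+ n) i j| < e.

Implicit Types (S : 'M[R]_(dsize k p q)) (v : 'cV[R]_(dsize k p q)).

Lemma rot_bounded : exists M, forall n x y, `|(T ^+ n) x y| <= M.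
Proof.
have [N hN] := hC ltr01.
pose MB : R := `|B ^+ false| + `|B ^+ true|.
(* The summand 1 bounds the rotation entries and those of [C ^+ n] for [N <= n]; the sum bounds the
   earlier powers of [C]. *)
pose MC : R := 1 + \sum_(n < N) `|C ^+ n|.
have MB0 : 0 <= MB by rewrite addr_ge0.
have MC1 : 1 <= MC by rewrite lerDl sumr_ge0.
have M0 : 0 <= MB + MC by rewrite addr_ge0// (le_trans _ MC1).
have M1 : 1 <= MB + MC by rewrite (le_trans MC1)// lerDr.
exists (MB + MC) => n x y; rewrite rotX.
case: (idxP x) => [i a|b|c]; case: (idxP y) => [j a'|b'|c']; rewrite dsumE ?normr0//.
- case: eqP => _; last by rewrite normr0.
  rewrite (le_trans _ M1)// mxE /=.
  by case: ifP => _; [|case: ifP => _]; rewrite ?normrN ?cos_max ?sin_max.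
- apply: (@le_trans _ _ MB); last by rewrite lerDl (le_trans _ MC1).
  rewrite (involX hB); apply: le_trans (mx_entry_le_norm _ _ _) _.
  by rewrite /MB; case: (odd n); rewrite ?lerDl ?lerDr.
- apply: (@le_trans _ _ MC); last by rewrite lerDr.
  have [Nn|nN] := leqP N n; first by rewrite (le_trans (ltW (hN n Nn _ _)))// lerDl sumr_ge0.
  apply: le_trans (mx_entry_le_norm _ _ _) _.
  by rewrite /MC (bigD1 (Ordinal nN))//= addrCA lerDl addr_ge0// sumr_ge0.
Qed.

Lemma OrbRef_attained S v : OrbRef T S ->
  exists2 A, closure (Orb T) A & S *m v = A *m v.
Proof.
have [M hM] := rot_bounded.
by move=> /(_ v) /(closure_image_mulmx (M := M)); apply => _ [n _ <-].
Qed.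

(** The scalars are unbounded, but near [S *m v] the coordinate [i0] of [c *: T ^+ n *m v], of
    modulus [|c|] times that of [v], is bounded. Since this coordinate of [v] is nonzero, [|c| <= K]
    and compactness applies. *)
Lemma ROrbRef_attained S v i0 : ROrbRef T S -> rot_coord v i0 != 0 ->
  exists2 A, closure (ROrb T) A & S *m v = A *m v.
Proof.
have [M hM] := rot_bounded.
move=> /(_ v) Sx x0.
have cx0 : 0 < cnorm (rot_coord v i0).
  rewrite lt_neqAle sqrtr_ge0 andbT eq_sym; apply: contraNneq x0 => e.
  have : complex.Re (rot_coord v i0) * complex.Re (rot_coord v i0) + complex.Im (rot_coord v i0)
    * complex.Im (rot_coord v i0) == 0.
    by rewrite eq_le -sqrtr_eq0 -/(cnorm (rot_coord v i0)) e eqxx /= addr_ge0// -expr2 sqr_ge0.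
  rewrite -!expr2 paddr_eq0 ?sqr_ge0// !sqrf_eq0 => /andP[/eqP r0 /eqP i00].
  by rewrite eq_complex r0 i00 !eqxx.
pose r := cnorm (rot_coord (S *m v) i0).
pose K := (r + 1) / cnorm (rot_coord v i0).
pose X := [set c *: T ^+ n | c in [set c : R | `|c| <= K] & n in [set: nat]].
have : closure [set A *m v | A in X] (S *m v).
  move=> U hU.
  have hV : nbhs (S *m v) [set y : 'cV[R]_(dsize k p q) | cnorm (rot_coord y i0) < r + 1].
    have cg : continuous (fun y : 'cV[R]_(dsize k p q) => cnorm (rot_coord y i0)).
      apply: ccont_cnorm; split.
        exact (@entry_continuous R _ _ (rot_idx p q i0 0) 0).
      exact (@entry_continuous R _ _ (rot_idx p q i0 1) 0).
    by apply: (cvgr_lt _ (cg (S *m v))); rewrite ltrDl.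
  have [_ [[_ [c _ [n _ <-]] <-] [Uc Vc]]] := Sx _ (filterI hU hV).
  exists ((c *: T ^+ n) *m v); split=> //; exists (c *: T ^+ n) => //; exists c; last by exists n.
  move: Vc; rewrite /= rotZX rot_coord_dsum !cnormM cnorm_real cnorm_expi mulr1 => Vc.
  by rewrite /K ler_pdivlMr// ltW.
move=> /(closure_image_mulmx (M := K * M)) [_ [c /= cK [n _ <-]] a b|A XA ->].
  by rewrite mxE normrM ler_pM.
by exists A => //; apply: closureS XA => _ [c _ [n _ <-]]; exists c => //; exists n.
Qed.

(** Testing [S] on a basis vector reads a column, so [S] inherits the zero blocks of the orbit. *)
Lemma ROrbRef_entry0 S x y : ROrbRef T S ->
  (forall A, ROrb T A -> A x y = 0) -> S x y = 0.
Proof.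
move=> /(_ (delta_mx y 0)) hS h0.
pose f (v : 'cV[R]_(dsize k p q)) : R := v x 0.
have : f (S *m delta_mx y 0) = 0.
  apply: (@closure_eq_fun _ _ _ f (fun=> 0)) hS.
  - exact: entry_continuous.
  - exact: cst_continuous.
  - by move=> _ [A XA <-]; rewrite /f -colE mxE h0.
by rewrite /f -colE mxE.
Qed.

(* [S] acts on the i-th plane by [u |-> lin_part S i * u + alin_part S i * conjc u]. *)
Definition lin_part (S : 'M[R]_(dsize k p q)) (i : 'I_k) : R[i] :=
  let s a b := S (rot_idx p q i a) (rot_idx p q i b) in
  ((s 0 0 + s 1 1) / 2) +i* ((s 1 0 - s 0 1) / 2).
Definition alin_part (S : 'M[R]_(dsize k p q)) (i : 'I_k) : R[i] :=
  let s a b := S (rot_idx p q i a) (rot_idx p q i b) in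
  ((s 0 0 - s 1 1) / 2) +i* ((s 1 0 + s 0 1) / 2).

Lemma rot_coord_mulmx S v i : ROrbRef T S ->
  rot_coord (S *m v) i = lin_part S i * rot_coord v i + alin_part S i * conjc (rot_coord v i).
Proof.
move=> hS.
have h a : (S *m v) (rot_idx p q i a) 0 = \sum_b S (rot_idx p q i a) (rot_idx p q i b) * v
  (rot_idx p q i b) 0.
  rewrite mxE sum_idx (bigD1 i)//= [X in _ + X + _ + _]big1 ?addr0 => [|i' i'i]; last first.
    rewrite big1// => b _; rewrite (ROrbRef_entry0 hS) ?mul0r// => _ [c _ [n _ <-]].
    by rewrite rotZX dsumE eq_sym (negbTE i'i).
  rewrite [X in _ + X + _]big1 ?addr0 => [|b _]; last first.
    by rewrite (ROrbRef_entry0 hS) ?mul0r// => _ [c _ [n _ <-]]; rewrite rotZX dsumE.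
  rewrite [X in _ + X]big1 ?addr0// => b _.
  by rewrite (ROrbRef_entry0 hS) ?mul0r// => _ [c _ [n _ <-]]; rewrite rotZX dsumE.
rewrite /rot_coord !h !big_ord_recl !big_ord0 /= !addr0.
rewrite (_ : lift ord0 ord0 = 1); last exact: val_inj.
rewrite -[ord0]/(0 : 'I_2) /lin_part /alin_part.
move: (v _ 0) (v _ 0) => x0 x1.
by apply/eqP; rewrite eq_complex /=; apply/andP; split; apply/eqP; field.
Qed.

End reflexive_cover.

(** * The rotation part of an element of the reflexive hull *)

Lemma poly_eq0_nat (F : numDomainType) (P : {poly F}) : (forall n : nat, P.[n%:R] = 0) -> P = 0.
Proof.
move=> h; apply: (roots_geq_poly_eq0 (rs := [seq n%:R | n <- iota 0 (size P)])).
- by apply/allP => _ /mapP[n _ ->]; rewrite /root h.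
- by rewrite map_inj_uniq ?iota_uniq// => m n /eqP; rewrite eqr_nat => /eqP.
- by rewrite size_map size_iota.
Qed.

Section rotation_part.
Variables (R : realType) (k p q : nat).

(* The coordinates of [const_mx 1] are all [1 + i], hence the division. *)
Definition rot_vector (z : 'I_k -> R[i]) : 'cV[R]_(dsize k p q) :=
  dsum (fun i => z i / (1 +i* 1)) 0 0 *m const_mx 1.

Lemma rot_coord_vector z i : rot_coord (rot_vector z) i = z i.
Proof.
rewrite rot_coord_dsum /rot_coord !mxE divfK//.
by rewrite eq_complex /= negb_and oner_eq0.
Qed.

Variables (theta : 'I_k -> R) (B : 'M[R]_p) (C : 'M[R]_q).
Let T : 'M[R]_(dsize k p q) := dsum (fun i => expi (theta i)) B C.
Hypothesis hB : B ^+ 2 = 1%:M.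
Hypothesis hC : forall e, 0 < e -> exists M, forall n, (M <= n)%N -> forall i j,
  `|(C ^+ n) i j| < e.

(* Test [S] on the vectors with j-th coordinate [u = 1 + i x] and the others equal to [1]. The
   relation satisfied by the closure becomes a polynomial identity in the real variable [x];
   evaluated at [x = i], where [u] vanishes but its formal conjugate [1 - i x] does not, it
   forces the antilinear part to vanish. *)
Lemma alin_part_eq0_pos (s : 'I_k -> int) (t : int) S j :
  \sum_i (s i)%:~R * theta i = 2 * pi * t%:~R -> (forall i, s i != 0) -> 0 < s j ->
  ROrbRef T S -> alin_part S j = 0.
Proof.
move=> st s0 sj hS.
pose P := lin_part S j; pose r := alin_part S j.
(* On a plane where the test vector has coordinate 1, the matrix agreeing with [S] must have entry
   [m i]; [c1] and [c2] collect the resulting constant factors. *)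
pose m i := lin_part S i + alin_part S i.
pose u (x : R) : R[i] := 1 +i* x.
have u0 x : u x != 0 by rewrite eq_complex /= negb_and oner_eq0.
pose w (z : R[i]) i := if 0 <= s i then z else conjc z.
pose c1 := (\prod_(i | i != j) w (m i) i ^+ absz (s i)) ^+ 2.
pose c2 := \prod_(i | i != j) (m i * conjc (m i)) ^+ absz (s i).
pose n := absz (s j).
have n0 : (0 < n)%N by rewrite absz_gt0 gt_eqF.
have key x : exists z, [/\ z * u x = P * u x + r * conjc (u x),
    z ^+ (2 * n) * c1 = (z * conjc z) ^+ n * c2 &
    forall i, i != j -> z * conjc z = m i * conjc (m i)].
  pose v := rot_vector (fun i => if i == j then u x else 1).
  have vE i : rot_coord v i = if i == j then u x else 1 by rewrite rot_coord_vector.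
  have [|A TA SA] := ROrbRef_attained (i0 := j) hB hC (v := v) hS.
    by rewrite vE eqxx.
  have zE i : rot_entry A i * rot_coord v i = lin_part S i * rot_coord v i + alin_part S i *
    conjc (rot_coord v i).
    rewrite -(rot_coord_mulmx _ _ hS) SA (closure_dsum TA) rot_coord_dsum.
    by rewrite -(closure_dsum TA).
  have zi i : i != j -> rot_entry A i = m i.
    by move=> /negbTE ij; have := zE i; rewrite vE ij conjc1 !mulr1.
  exists (rot_entry A j); split.
  - by have := zE j; rewrite vE eqxx.
  - have := closure_rel st TA.
    rewrite (bigD1 j)//= [in RHS](bigD1 j)//= (ltW sj) exprMn -exprM mulnC => e.
    rewrite /c1 /n (eq_bigr (fun i => w (rot_entry A i) i ^+ `|s i|)); last first.
      by move=> i ij; rewrite (zi i ij).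
    have e2 : \prod_(i | i != j) (rot_entry A i * conjc (rot_entry A i)) ^+ `|s i| = c2.
      by rewrite (eq_bigr (fun i => (m i * conjc (m i)) ^+ `|s i|))// => i ij; rewrite (zi i ij).
    by rewrite e e2.
  - by move=> i ij; rewrite (closure_rot_entry_norm j i TA) (zi i ij).
(* [U] and [U'] represent [u x] and its conjugate for real [x], and [Y] and [Y'] represent [z * u x]
   and its conjugate. [Q] is the relation multiplied by the power [2 n] of [u x * conjc (u x)],
   which removes the unknown [z]. *)
pose U : {poly R[i]} := 1 + 'i%C *: 'X.
pose U' : {poly R[i]} := 1 - 'i%C *: 'X.
pose Y := P *: U + r *: U'.
pose Y' := (conjc P) *: U' + (conjc r) *: U.
pose Q := c1 *: (Y ^+ (2 * n) * U' ^+ (2 * n)) - c2 *: (Y * Y' * (U * U')) ^+ n.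
have natC (a : nat) : a%:R = (a%:R : R)%:C :> R[i] by rewrite (rmorph_nat (real_complex R)).
have UE (a : nat) : U.[a%:R] = u a%:R.
  rewrite /U !hornerE natC; apply/eqP; rewrite eq_complex /=.
  by apply/andP; split; apply/eqP; ring.
have U'E (a : nat) : U'.[a%:R] = conjc (u a%:R).
  rewrite /U' !hornerE natC; apply/eqP; rewrite eq_complex /=.
  by apply/andP; split; apply/eqP; ring.
have Q0 : Q = 0.
  apply: poly_eq0_nat => a; have [z [zu zc _]] := key a%:R.
  have YE : Y.[a%:R] = z * u a%:R by rewrite /Y hornerD !hornerZ UE U'E zu.
  have Y'E : Y'.[a%:R] = conjc z * conjc (u a%:R).
    by rewrite /Y' hornerD !hornerZ UE U'E -[RHS]conjcM zu conjcD !conjcM conjcK.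
  rewrite /Q hornerD hornerN !hornerZ !horner_exp !hornerM !horner_exp YE Y'E UE U'E.
  apply/eqP; rewrite subr_eq0; apply/eqP.
  transitivity ((u a%:R * conjc (u a%:R)) ^+ (2 * n) * (z ^+ (2 * n) * c1)).
    by rewrite !exprMn; ring.
  by rewrite zc exprM mulrA -exprMn mulrC; congr (_ * _ ^+ _); ring.
have Ui : U.['i%C] = 0.
  by rewrite /U !hornerE; apply/eqP; rewrite eq_complex /=; apply/andP; split; apply/eqP; ring.
have U'i : U'.['i%C] = 2.
  rewrite /U' !hornerE (natC 2%N); apply/eqP; rewrite eq_complex /=; apply/andP; split;
    apply/eqP; ring.
have : Q.['i%C] = 0 by rewrite Q0 horner0.
rewrite /Q hornerD hornerN !hornerZ !horner_exp !hornerM !horner_exp Ui mul0r mulr0 expr0n.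
rewrite (gtn_eqF n0) mulr0 subr0 /Y hornerD !hornerZ Ui U'i mulr0 add0r.
move=> /eqP; rewrite mulf_eq0 => /orP[c10|]; last first.
  rewrite mulf_eq0 !expf_eq0 muln_gt0 n0 /= mulf_eq0 pnatr_eq0 !orbF.
  by move=> /eqP.
(* If [c1 = 0], some [m i] vanishes; all entries having equal modulus, [z = 0] for every [x], and
   the values at 0 and 1 give [P = r = 0]. *)
move: c10; rewrite /c1 expf_eq0 /= => /prodf_eq0[i ij].
rewrite expf_eq0 => /andP[_ wi].
have mi : m i = 0.
  by move: wi; rewrite /w; case: ifP => _; rewrite ?conjc_eq0 => /eqP.
have yz x : P * u x + r * conjc (u x) = 0.
  have [z [zu _ /(_ i ij)]] := key x.
  rewrite mi mul0r => /eqP; rewrite mulf_eq0 conjc_eq0 orbb => /eqP z0.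
  by rewrite -zu z0 mul0r.
have := yz 0; have := yz 1; rewrite /u /P /r; move: (lin_part S j) (alin_part S j) =>
  [a b] [c d] [e1 e2] [e3 e4].
by apply/eqP; rewrite eq_complex /=; apply/andP; split; apply/eqP; lra.
Qed.

Lemma alin_part_eq0 (s : 'I_k -> int) (t : int) S j :
  \sum_i (s i)%:~R * theta i = 2 * pi * t%:~R -> (forall i, s i != 0) ->
  ROrbRef T S -> alin_part S j = 0.
Proof.
move=> st s0 hS; have [sj|sj] := ltrP 0 (s j).
  exact: (alin_part_eq0_pos st s0 sj).
apply: (@alin_part_eq0_pos (fun i => - s i) (- t)) => //.
- rewrite mulrNz mulrN -st -sumrN; apply: eq_bigr => i _; by rewrite mulrNz mulNr.
- by move=> i; rewrite oppr_eq0.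
- by rewrite oppr_gt0 lt_neqAle s0.
Qed.
End rotation_part.

(** * Countable covers along the moment curve *)

(** A countable set has Lebesgue measure 0, unlike the unit interval. *)
Lemma uncountable_real (R : realType) : ~ countable [set: R].
Proof.
move=> /(sub_countable (subset_card_le (@subsetT _ `[0, 1]%classic))).
move=> /countable_lebesgue_measure0; rewrite lebesgue_measure_itv /= lte_fin ltr01.
by rewrite oppr0 adde0 => /eqP; rewrite eqe oner_eq0.
Qed.

Lemma finite_roots (F : fieldType) (P : {poly F}) : P != 0 -> finite_set [set x | root P x].
Proof.
have [n] := ubnP (size P); elim: n P => // n IH P sP P0.
have [[a Pa]|h] := pselect (exists a, root P a); last first.
  rewrite (_ : [set x | _] = set0)//; apply/seteqP; split=> x //= Px.
  by apply: h; exists x.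
have /factor_theorem[Q PQ] := Pa.
have Q0 : Q != 0 by apply: contraNneq P0 => Q0; rewrite PQ Q0 mul0r.
have : finite_set ([set x | root Q x] `|` [set a]).
  rewrite finite_setU; split; last exact: finite_set1.
  apply: IH => //; move: sP; rewrite PQ size_Mmonic ?monicXsubC// size_XsubC addn2 /=.
  by rewrite ltnS.
apply: sub_finite_set => x /=; rewrite PQ rootM root_XsubC => /orP[Qx|/eqP ->].
  by left.
by right.
Qed.

Definition moment_curve (R : realType) (N : nat) (t : R) : 'cV[R]_N := \col_y t ^+ y.

(** If [S] differs from [A] in some row, the parameters where they agree are roots of the nonzero
    polynomial formed from the difference of these rows. Were [S] outside [X], the real line would
    be a countable union of finite sets. *)
Lemma countable_curve_cover (R : realType) (m N : nat) (X : set 'M[R]_(m, N)) S :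
  countable X ->
  (forall t, t != 0 -> exists2 A, X A & S *m moment_curve N t = A *m moment_curve N t) ->
  X S.
Proof.
move=> cX hX; apply: contrapT => nS.
apply: (@uncountable_real R).
pose Z A := [set t | S *m moment_curve N t = A *m moment_curve N t].
have curveE (A : 'M[R]_(m, N)) t x : (A *m moment_curve N t) x 0 = \sum_i A x i * t ^+ i.
  by rewrite mxE; apply: eq_bigr => i _; rewrite mxE.
have cZ A : X A -> countable (Z A).
  move=> XA; apply: finite_set_countable.
  have [x [y SA]] : exists x y, S x y != A x y.
    apply: contrapT => h; apply: nS; suff -> : S = A by [].
    apply/matrixP => x y; apply/eqP; apply: contrapT => hxy; apply: h.
    by exists x, y; apply/negP.
  pose P := \poly_(i < N) (if insub i is Some j then S x j - A x j else 0).
  apply: sub_finite_set (@finite_roots _ P _) => [t /= /matrixP /(_ x 0) e|]; last first.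
    apply/eqP => /polyP /(_ y); rewrite coef_poly ltn_ord valK coef0 => /eqP.
    by rewrite subr_eq0 (negbTE SA).
  rewrite /root horner_poly (eq_bigr (fun i => (S x i - A x i) * t ^+ i)).
    rewrite (eq_bigr (fun i => S x i * t ^+ i - A x i * t ^+ i)); last first.
      by move=> i _; rewrite mulrBl.
    by rewrite sumrB; move: e; rewrite !curveE => ->; rewrite subrr eqxx.
  by move=> i _; rewrite valK.
pose F (b : bool) := if b then [set 0] else \bigcup_(A in X) Z A.
have cF : countable (\bigcup_(b in [set: bool]) F b).
  apply: bigcup_countable; first exact: countableP.
  move=> [] _; first exact: finite_set_countable (finite_set1 _).
  exact: bigcup_countable.
apply: sub_countable cF; apply: subset_card_le => t _.
have [->|/hX[A XA e]] := eqVneq t 0; first by exists true.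
by exists false => //; exists A.
Qed.

(** * Reflexivity from a relation with nonzero coefficients *)

Section reflexivity.
Variables (R : realType) (k p q : nat) (theta : 'I_k -> R) (B : 'M[R]_p) (C : 'M[R]_q).
Let T : 'M[R]_(dsize k p q) := dsum (fun i => expi (theta i)) B C.
Hypothesis hB : B ^+ 2 = 1%:M.
Hypothesis hC : forall e, 0 < e -> exists M, forall n, (M <= n)%N -> forall i j,
  `|(C ^+ n) i j| < e.
Variables (s : 'I_k -> int) (t : int) (i0 : 'I_k).
Hypothesis st : \sum_i (s i)%:~R * theta i = 2 * pi * t%:~R.
Hypothesis s0 : forall i, s i != 0.

(* Once the rotation part of [S] is known to be complex linear, the matrices in the closure
   that can agree with [S] on a generic vector form a countable family. *)
Lemma reflexive_cover (K : set 'M[R]_(dsize k p q)) S :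
  K `<=` closure (ROrb T) -> ROrbRef T S ->
  (forall v, rot_coord v i0 != 0 -> exists2 A, K A & S *m v = A *m v) -> K S.
Proof.
move=> KT hS hK.
pose l := cnorm (lin_part S i0).
(* The left summand lists the scaled powers whose scalar has absolute value [l]; the right one lists
   the other possible limits, with involution block plus or minus [l] times a power of [B] and zero
   contraction block. *)
pose fam (x : bool * nat + bool * bool) : 'M[R]_(dsize k p q) :=
  match x with
  | inl (sg, n) => ((-1) ^+ sg * l) *: T ^+ n
  | inr (sg, par) => dsum (lin_part S) (((-1) ^+ sg * l) *: B ^+ par) 0
  end.
suff [] : (K `&` range fam) S by [].
apply: countable_curve_cover.
  apply: sub_countable (_ : countable (range fam)); first exact: subset_card_le (@subIsetr _ _ _).
  apply: sub_countable (card_image_le _ _) _; exact: countableP.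
move=> x x0; set v := moment_curve _ x.
have vi i : rot_coord v i != 0.
  by rewrite /rot_coord !mxE eq_complex /= negb_and expf_neq0.
have [A KA SA] := hK v (vi i0).
have TA := KT _ KA.
exists A => //; split=> //.
(* The antilinear part of [S] vanishes and no complex coordinate of [v] is 0, so each rotation entry
   is found by division. *)
have zA : rot_entry A = lin_part S.
  apply/funext => i; apply: (mulIf (vi i)).
  rewrite -(rot_coord_dsum (rot_entry A) (invol_block A) (contr_block A)) -(closure_dsum TA) -SA
    (rot_coord_mulmx _ _ hS).
  by rewrite (alin_part_eq0 hB hC _ st s0 hS) mul0r addr0.
have [[c [n AE]]|nA] := pselect (exists c n, A = c *: T ^+ n).
  have lc : l = `|c| by rewrite /l -zA AE cnorm_rotZX.
  have [c0|c0] := leP 0 c.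
    by exists (inl (false, n)) => //=; rewrite mul1r lc ger0_norm.
  by exists (inl (true, n)) => //=; rewrite mulN1r lc ltr0_norm// opprK.
have nA' c n : A <> c *: T ^+ n by move=> AE; apply: nA; exists c, n.
have [sg [par BA]] := closure_invol_block hB i0 TA.
exists (inr (sg, par)) => //=.
by rewrite [RHS](closure_dsum TA) (closure_contr_block hC i0 TA nA') BA zA.
Qed.

Lemma rel_orbit_reflexive : orbit_reflexive T.
Proof.
have sub : Orb T `<=` ROrb T.
  by move=> _ [n _ <-]; exists 1 => //; exists n => //; rewrite scale1r.
apply/seteqP; split=> [S hS|S hS v]; last exact: image_closure_mulmx.
apply: reflexive_cover.
- exact: closureS.
- by move=> v; apply: closureS (hS v) => _ [A XA <-]; exists A => //; exact: sub.
- by move=> v _; exact: OrbRef_attained.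
Qed.

Lemma rel_R_orbit_reflexive : R_orbit_reflexive T.
Proof.
apply/seteqP; split=> [S hS|S hS v]; last exact: image_closure_mulmx.
apply: reflexive_cover => //.
by move=> v; exact: ROrbRef_attained.
Qed.
End reflexivity.

(** * Failure of reflexivity for independent angles *)

(** The squared distance between [expi a] and [expi b] is [2 - 2 cos (a - b)]. *)
Lemma cos_sin_close (R : realType) (a b e : R) : 0 < e -> 1 - e ^+ 2 / 2 < cos (a - b) ->
  `|cos a - cos b| < e /\ `|sin a - sin b| < e.
Proof.
move=> e0; rewrite cosB => h.
have sq : (cos a - cos b) ^+ 2 + (sin a - sin b) ^+ 2 < e ^+ 2.
  have := cos2Dsin2 a; have := cos2Dsin2 b; rewrite !expr2 in h *; nra.
have lt_e (x : R) : x ^+ 2 < e ^+ 2 -> `|x| < e.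
  by rewrite -(real_normK (num_real x)) ltr_pXn2r// nnegrE ltW.
split; apply: lt_e; apply: le_lt_trans sq; first by rewrite lerDl sqr_ge0.
by rewrite lerDr sqr_ge0.
Qed.

Lemma rot_idx_eq (k p q : nat) (i j : 'I_k) (a b : 'I_2) :
  (rot_idx p q i a == rot_idx p q j b) = (i == j) && (a == b).
Proof.
rewrite /rot_idx !(inj_eq (@lshift_inj _ _)) -val_eqE.
exact: (tagnat.eq_Rank (p_ := fun=> 2%N)).
Qed.

Section not_reflexive.
Variables (R : realType) (k p q : nat) (theta : 'I_k -> R) (B : 'M[R]_p) (C : 'M[R]_q).
Let T : 'M[R]_(dsize k p q) := dsum (fun i => expi (theta i)) B C.
Hypothesis hB : B ^+ 2 = 1%:M.
Hypothesis hC : forall e, 0 < e -> exists M, forall n, (M <= n)%N -> forall i j,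
  `|(C ^+ n) i j| < e.
Variable j : 'I_k.
Hypothesis hj : ~ spanQ ([set 1] `|` [set theta i / (2 * pi) | i in [set i | i != j]])
                        (theta j / (2 * pi)).

Definition rot_at (x : R) : 'M[R]_(dsize k p q) :=
  dsum (fun i => if i == j then expi x else 1) 1%:M 0.

Lemma rot_at_closure x : closure (Orb T) (rot_at x).
Proof.
move=> U /nbhs_ballP[e /= e0 eU].
have [M hM] := hC e0.
pose alpha i := if i == j then x else 0.
(* Kronecker's theorem is applied to the doubled angles so that only even powers occur, on which [B]
   becomes the identity; [M <= m] makes the power of [C] small. *)
have [|||m [Mm hm]] := @kronecker R k (fun i => 2 * theta i) alpha j _ _ (e ^+ 2 / 2) M _.
- by move=> i /negbTE ij; rewrite /alpha ij.
- move=> s t st; apply: contrapT => /eqP sj; apply: hj.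
  apply: (@rel_spanQ _ _ _ _ (fun i => 2 * s i) t); last by rewrite mulf_neq0.
  by rewrite -st; apply: eq_bigr => i _; rewrite intrM; ring.
- by rewrite divr_gt0// exprn_gt0.
have {}hm i : `|cos (alpha i) - cos ((2 * m)%:R * theta i)| < e /\
              `|sin (alpha i) - sin ((2 * m)%:R * theta i)| < e.
  apply: cos_sin_close => //; rewrite -cosN opprB natrM.
  by have := hm i; rewrite mulrCA mulrA.
exists (T ^+ (2 * m)%N); split; first by exists (2 * m)%N.
apply: eU; split=> // a b; rewrite /ball /= rotX.
have -> : B ^+ (2 * m) = 1%:M by rewrite (involX hB) mul2n odd_double.
have alphaE i : (if i == j then expi x else 1) = expi (alpha i).
  by rewrite /alpha; case: ifP => //; rewrite expi0.
case: (idxP a) => [i a'|b'|c]; case: (idxP b) => [i' b''|b''|c'];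
  rewrite /rot_at !dsumE ?subrr ?normr0//.
- case: eqP => _; last by rewrite subrr normr0.
  rewrite alphaE !mxE /=; have [h1 h2] := hm i.
  by case: (a' == b'') => //; case: (a' == 0) => //; rewrite opprK addrC distrC.
- rewrite mxE sub0r normrN; apply: hM; apply: leq_trans Mm _; lia.
Qed.

(* A reflection in the j-th plane maps each vector like a rotation depending on the vector. *)
Definition refl_at : 'M[R]_(dsize k p q) :=
  dsum (fun=> 1) 1%:M 0 - 2 *: delta_mx (rot_idx p q j 1) (rot_idx p q j 1).

(** Elements of the closure have equal diagonal entries in each plane, while those of the reflection
    are 1 and -1. *)
Lemma refl_at_notin : ~ closure (ROrb T) refl_at.
Proof.
move=> /closure_dsum /matrixP h.
have := h (rot_idx p q j 1) (rot_idx p q j 1); rewrite !dsumE eqxx [complex_mx _ _ _]mxE /=.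
have rn : rot_idx p q j 0 != rot_idx p q j 1.
  by rewrite rot_idx_eq andbF.
rewrite /refl_at [X in X = _ -> _]mxE [X in _ = X ->
  _]mxE !dsum_rr !eqxx !mxE !eqxx (negbTE rn) /=; lra.
Qed.

Lemma refl_at_rot (v : 'cV[R]_(dsize k p q)) : exists x, refl_at *m v = rot_at x *m v.
Proof.
pose u := rot_coord v j.
(* The reflection conjugates the complex coordinate [u]; when [u] is nonzero, [conjc u / u] has
   modulus 1 and is the required rotation. *)
have [x xu] : exists x, expi x * u = conjc u.
  have [u0|u0] := eqVneq u 0; first by exists 0; rewrite u0 mulr0 conjc0.
  have uu : conjc u != 0 by rewrite conjc_eq0.
  case wE: (conjc u / u) => [a b].
  have ww : (a +i* b) * conjc (a +i* b) = 1.
    have wu : (a +i* b) * u = conjc u by rewrite -wE divfK.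
    have wu' : conjc (a +i* b) * conjc u = u by rewrite -conjcM wu conjcK.
    apply: (mulIf uu); rewrite mul1r -mulrA wu'; exact: wu.
  have [x xE] : exists x, expi x = a +i* b.
    apply: expi_onto; move: ww => -[+ _]; rewrite !expr2 => <-; ring.
  by exists x; rewrite xE -wE divfK.
exists x; apply/eqP; rewrite -subr_eq0 -mulmxBl; apply/eqP.
have -> : refl_at - rot_at x = dsum (fun i => if i == j then 1 - expi x else 0) 0 0
    - 2 *: delta_mx (rot_idx p q j 1) (rot_idx p q j 1).
  rewrite /refl_at addrAC; congr (_ - _); apply/matrixP => a b.
  rewrite /rot_at [LHS]mxE [X in _ + X = _]mxE.
  case: (idxP a) => [i a'|b'|c]; case: (idxP b) => [i' b''|b''|c'];
    rewrite !dsumE ?subrr ?mxE ?subrr//.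
  case: eqP => _; last by rewrite subrr.
  by case: (i == j); rewrite ?mxE; case: (a' == b'') => //=; case: (a' == 0) => //=; ring.
rewrite mulmxBl -scalemxAl.
set D := dsum _ _ _.
have Dv i : rot_coord (D *m v) i = if i == j then u - conjc u else 0.
  rewrite rot_coord_dsum; case: eqP => [->|_]; last by rewrite mul0r.
  by rewrite mulrBl mul1r xu.
have dv y : (delta_mx (rot_idx p q j 1) (rot_idx p q j 1) *m v) y 0 = (y == rot_idx p q j 1)%:R
  * v (rot_idx p q j 1) 0.
  rewrite mxE (bigD1 (rot_idx p q j 1))//= big1 ?addr0 ?mxE ?eqxx ?andbT// => y' /negbTE ne.
  by rewrite mxE ne andbF mul0r.
apply/matrixP => y o;
  rewrite (ord1 o) [LHS]mxE [X in _ + X = _]mxE [X in _ - X = _]mxE dv [RHS]mxE.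
have row0 y' : (forall y'', D y' y'' = 0) -> (D *m v) y' 0 = 0.
  by move=> h; rewrite mxE big1// => y'' _; rewrite h mul0r.
case: (idxP y) => [i a|b|c].
- have [->|ij] := eqVneq i j; last first.
    have := Dv i; rewrite (negbTE ij) => -[d0 d1].
    rewrite rot_idx_eq (negbTE ij) mul0r mulr0 subr0.
    by move: a; apply: ord2P.
  have := Dv j; rewrite eqxx /u /rot_coord /= => -[d0 d1].
  move: a; apply: ord2P; rewrite rot_idx_eq eqxx /=.
    by rewrite d0 mul0r mulr0 subr0 subrr.
  by rewrite d1 mul1r; ring.
- rewrite row0 => [|y']; last first.
    by case: (idxP y') => *; rewrite dsumE// mxE.
  by rewrite /invol_idx /rot_idx (inj_eq (@lshift_inj _ _)) eq_rlshift mul0r mulr0 subr0.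
- rewrite row0 => [|y']; last first.
    by case: (idxP y') => *; rewrite dsumE// mxE.
  by rewrite /contr_idx /rot_idx eq_rlshift mul0r mulr0 subr0.
Qed.

Lemma refl_at_OrbRef : OrbRef T refl_at.
Proof.
by move=> v; have [x ->] := refl_at_rot v; apply: image_closure_mulmx; exact: rot_at_closure.
Qed.

Lemma closure_Orb_ROrb : closure (Orb T) `<=` closure (ROrb T).
Proof.
apply: closureS => _ [n _ <-]; exists 1 => //; exists n => //; exact: scale1r.
Qed.

Lemma not_orbit_reflexive : ~ orbit_reflexive T.
Proof.
move=> e; apply: refl_at_notin; apply: closure_Orb_ROrb.
by rewrite -[closure (Orb T)]e; exact: refl_at_OrbRef.
Qed.

Lemma not_R_orbit_reflexive : ~ R_orbit_reflexive T.
Proof.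
move=> e; apply: refl_at_notin; rewrite -[closure (ROrb T)]e => v.
apply: closureS (@refl_at_OrbRef v) => _ [_ [n _ <-] <-].
exists (T ^+ n) => //; exists 1 => //; exists n => //; exact: scale1r.
Qed.
End not_reflexive.

(* The equivalence of the four conditions *)
Local Close Scope complex_scope.

Theorem lemma6 (R : realType) (k p q : nat) (theta : 'I_k -> R)
    (B : 'M[R]_p) (C : 'M[R]_q) (T : 'M[R]_(\sum_(i < k) 2 + p + q))
    (hk : (1 <= k)%N)
    (htheta : forall i, 0 <= theta i < 2 * pi)
    (hB : B ^+ 2 = 1%:M)
    (hC : spectral_radius (map_mx (real_complex R) C) < 1)
    (hT : T = block_mx
                (block_mx (\mxdiag_(i < k) rotation (theta i)) 0 0 B) 0
                0 C) :
  [<-> orbit_reflexive T;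
       R_orbit_reflexive T;
       exists (s : 'I_k -> int) (t : int),
         (forall j, s j != 0) /\
         \sum_(j < k) (s j)%:~R * theta j = 2 * pi * t%:~R;
       forall j : 'I_k,
         spanQ ([set 1] `|` [set theta i / (2 * pi) | i in [set i | i != j]])
               (theta j / (2 * pi))].
Proof.
have C0 := spectral_radius_lt1_cvg0 hC.
(* [rotation (theta i)] and [complex_mx (expi (theta i))] are convertible. *)
have {hT}-> : T = dsum (fun i => expi (theta i)) B C by [].
pose i0 : 'I_k := Ordinal hk.
have H34 : (exists (s : 'I_k -> int) (t : int), (forall j, s j != 0) /\
    \sum_(j < k) (s j)%:~R * theta j = 2 * pi * t%:~R) <->
  forall j : 'I_k,
    spanQ ([set 1] `|` [set theta i / (2 * pi) | i in [set i | i != j]])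
      (theta j / (2 * pi)).
  split=> [[s [t [s0 st]]] j|h]; first exact: rel_spanQ st (s0 j).
  by apply: rel_all_neq0 => j; exact: spanQ_rel.
tfae.
(* The step from (1) to (2) passes through the arithmetic condition: an independent angle would
   contradict (1), and a relation yields (2). *)
- move=> h; have /H34[s [t [s0 st]]] : forall j : 'I_k,
    spanQ ([set 1] `|` [set theta i / (2 * pi) | i in [set i | i != j]])
      (theta j / (2 * pi)).
    by move=> j; apply: contrapT => hj; exact: (not_orbit_reflexive hB C0 hj).
  exact: (rel_R_orbit_reflexive hB C0 i0 st s0).
- move=> h; apply/H34 => j; apply: contrapT => hj.
  exact: (not_R_orbit_reflexive hB C0 hj).
- by move/H34.
- move=> /H34[s [t [s0 st]]]; exact: (rel_orbit_reflexive hB C0 i0 st s0).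
Qed.
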